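(* 1. For $r\ge1$, $\chi\in\mathcal{G}_r$ and $z\in\mathbb{C}$, $|z|<1$, one has $\ell_r(z)=\ell_r(\chi z)$ and $e^{\ell_r(z)}=e^{\ell_r(\chi z)}$ for $r\ge1$. In particular, for $r$ even, as $-1\in\mathcal{G}_r$, the functions $\ell_r$ and $e^{\ell_r}$ are even. 2. For $r\ge1$ and $|z|<1$, $$\ell_r(z)=-\sum_{\chi\in G_r}\log\Gamma(1+\chi z)\quad\text{and}\quad e^{\ell_r(z)}=\prod_{\chi\in G_r}e^{\gamma\chi z}\prod_{n\ge1}\Big(1+\frac{\chi z}{n}\Big)e^{-\chi z/n}.$$ 3. For any odd $r\ge2$, $$\Gamma_{y_r}^{-1}(1+z)=e^{\ell_r(z)}=\Gamma^{-1}(1+z)\prod_{\chi\in G_r\setminus\{1\}}e^{\ell_1(\chi z)}.$$ 4. In general, for any odd or even $r\ge2$, $$e^{\ell_r(z)}=\prod_{\chi\in G_r}e^{\ell_1(\chi z)}=\prod_{n\ge1}\Big(1+\frac{z^r}{n^r}\Big).$$ 5. For $r\ge1$, the function $\ell_r$ is holomorphic on the open unit disc $D_{<1}$. 6. For $r\ge1$, the function $e^{\ell_r}$ (resp. $e^{-\ell_r}$) is entire (resp. meromorphic), and admits a countable set of isolated zeroes (resp. poles) on the complex plane, which is $\biguplus_{\chi\in G_r}\chi\,\mathbb{Z}_{\le-1}$ (disjoint union).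
   Context: $D_{<1}$ is the open unit disc; $\gamma$ is Euler's constant, $\zeta$ the Riemann zeta function, $\Gamma$ Euler's gamma function, and $\Gamma^{-1}(1+z)=1/\Gamma(1+z)$. For $|z|<1$, $$\ell_1(z)=\gamma z-\sum_{n\ge2}\zeta(n)\frac{(-z)^n}{n},\qquad \ell_r(z)=-\sum_{n\ge1}\zeta(nr)\frac{(-z^r)^n}{n}\quad(r\ge2),$$ and $\Gamma_{y_r}(1+z):=e^{-\ell_r(z)}$, $\Gamma_{y_r}^{-1}(1+z)=e^{\ell_r(z)}$. For $r\ge1$, $\mathcal{G}_r$ is the group of solutions of $z^r=1$ and $G_r$ is the set of solutions of $z^r=(-1)^{r-1}$ in $\mathbb{C}$ (so $G_r=\mathcal{G}_r$ if $r$ is odd). $\log\Gamma(1+\cdot)$ on $D_{<1}$ denotes the holomorphic branch vanishing at $0$. The functions $e^{\pm\ell_r}$ in item 6 are understood as extended from $D_{<1}$ by analytic (meromorphic) continuation to $\mathbb{C}$. $\mathbb{Z}_{\le-1}$ is the set of negative integers. *)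

(* Defs.v *)
(* MathComp-Analysis over an arbitrary R : realType; complex numbers are R[i]. *)
From mathcomp Require Import all_boot all_order all_algebra.
From mathcomp Require Import complex.
From mathcomp Require Import all_classical all_reals all_analysis.

Set Implicit Arguments.
Unset Strict Implicit.
Unset Printing Implicit Defensive.
Import Order.TTheory GRing.Theory Num.Theory numFieldNormedType.Exports.
Local Open Scope classical_set_scope.
Local Open Scope ring_scope.
Local Open Scope complex_scope.

(* Naming R[i] as a numClosedFieldType gives it the topology and the
   normed-module structure that every numFieldType has over itself. *)
Definition Cplx (R : realType) : numClosedFieldType := R[i].

(* The notation \prod_(i \in A) is not provided for classical sets. *)
Definition fsprod (I : choiceType) (S : comPzRingType) (A : set I)
    (F : I -> S) : S :=
  \big[*%R/1]_(i \in A) F i.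

Section ComplexFunctions.
Variable R : realType.
Local Notation C := (Cplx R).
Implicit Types (z w s p : C) (f g L : C -> C) (D : set C).

Definition ofR (x : R) : C := x%:C.

Definition cexp z : C :=
  ofR (expR (complex.Re z)) * (cos (complex.Im z) +i* sin (complex.Im z)).

Definition unit_disc : set C := [set z | `|z| < 1].

(* C is a normed space over itself here, so this is complex differentiability.
   It is holomorphy on D when D is open. *)
Definition holomorphic_on D f : Prop := forall z, D z -> derivable f z 1.

Definition entire f : Prop := holomorphic_on setT f.

(* The value of f at p itself is irrelevant. *)
Definition pole f p : Prop :=
  exists m g, [/\ (0 < m)%N,
    \forall z \near p, derivable g z 1,
    g p != 0 &
    \forall z \near p^', f z = g z / (z - p) ^+ m].

Definition meromorphic f : Prop :=
  forall p, (\forall z \near p, derivable f z 1) \/ pole f p.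

(* Euler's integral; meaningful for 0 < Re s. *)
Definition Gamma s : C :=
  let integrand (t : R) := cexp ((s - 1) * ofR (ln t)) * ofR (expR (- t)) in
  (\int[lebesgue_measure]_(t in `]0%R, +oo[) complex.Re (integrand t))
  +i* (\int[lebesgue_measure]_(t in `]0%R, +oo[) complex.Im (integrand t)).

(* The branch of log Gamma(1 + z) on the unit disc that vanishes at 0. *)
Definition is_log_Gamma1 L : Prop :=
  [/\ holomorphic_on unit_disc L, L 0 = 0 &
      forall z, unit_disc z -> cexp (L z) = Gamma (1 + z)].

Definition euler_gamma : R :=
  limn (fun n => series (@harmonic R) n - ln n%:R).

(* The Riemann zeta function at an integer s >= 2. *)
Definition zeta (s : nat) : R :=
  limn (fun N => \sum_(1 <= k < N) (k%:R ^- s : R)).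

Definition ell_partial (r : nat) z (N : nat) : C :=
  if r == 1%N then
    ofR euler_gamma * z
    - \sum_(2 <= n < N) ofR (zeta n) * ((- z) ^+ n / n%:R)
  else - \sum_(1 <= n < N) ofR (zeta (n * r)) * ((- z ^+ r) ^+ n / n%:R).

Definition ell (r : nat) z : C := limn (ell_partial r z).

Definition Gamma_y (r : nat) w : C := cexp (- ell r (w - 1)).

Definition unity_roots (r : nat) : set C := [set z | z ^+ r = 1].

(* Only used for 0 < r, where this set is finite. *)
Definition G (r : nat) : set C := [set z | z ^+ r = (-1) ^+ r.-1].

Definition negative_integers : set C :=
  [set m%:~R | m in [set m : int | m <= -1]].

Definition ray (chi : C) : set C := [set chi * m | m in negative_integers].

Definition weierstrass_partial z (N : nat) : C :=
  \prod_(1 <= n < N) ((1 + z / n%:R) * cexp (- z / n%:R)).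

Definition product_partial (r : nat) z (N : nat) : C :=
  \prod_(1 <= n < N) (1 + z ^+ r / n%:R ^+ r).

End ComplexFunctions.

Arguments unit_disc {R} _.
Arguments unity_roots R r _ : clear implicits.
Arguments G R r _ : clear implicits.
Arguments euler_gamma R : clear implicits.

(* Main.v *)
Require Import Defs.
From mathcomp Require Import all_boot all_order all_algebra.
From mathcomp Require Import complex.
From mathcomp Require Import all_classical all_reals all_analysis.
From mathcomp Require Import cyclic separable cyclotomic measurable_realfun.
From mathcomp Require Import ring lra.

(** Everything reduces to the Weierstrass product
      E(z) = e^(gamma z) prod_(n >= 1) (1 + z/n) e^(-z/n),
    called [invGamma] below. Three facts about E carry the theorem.

    First, E is an entire function with E = exp(ell_1) on the unit disc, whose
    zeros are the negative integers. Let 0 <= x_n <= 1 with sum x_n^2 finite.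
    Expanding each log(1 + x_n u) - x_n u in powers of u, and summing over n
    before summing over the powers, gives a power series with bounded
    coefficients; it is holomorphic for |u| < 1, and its exponential is the
    product of the (1 + x_n u) e^(-x_n u) ([cvg_prod_log]). The weights
    x_n = 1/(n+1) give ell_1 ([ell1E]). The weights x_n = (M+1)/(M+n+1) at
    u = z/(M+1) give the tail of the product after M factors, valid for
    |z| < M+1. Hence on each of these discs E is a finite product times the
    exponential of a holomorphic function ([invGammaE]). Convergence,
    holomorphy, the zeros and the finiteness of their orders are read off from
    that formula.

    Secondly, Gamma(1+z) E(z) = 1 for |z| < 1 ([Gamma_invGamma]). This is
    Gauss's argument: the integrals of t^z (1 - t/N)^N over ]0, N] tend to
    Gamma(1+z) by dominated convergence, while their exact values
    N! N^(z+1) / ((z+1) ... (z+N+1)) ([gauss_integral]), multiplied by partial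
    products of E, tend to 1. Consequently - ell_1 is a logarithm of
    Gamma(1+z). It is the only one that vanishes at 0, since a holomorphic f
    with e^f = 1 on the disc has f' = 0.

    Thirdly, G_r is a coset of the group of r-th roots of unity. So the sum of
    the chi^n over G_r vanishes unless r divides n, and the product of the
    1 + chi w is 1 + w^r ([twisted_roots]). The first identity turns the partial
    sums of ell_r(z) into sums of partial sums of the ell_1(chi z)
    ([ell_partial_sum]), whence ell_r(z) = sum_chi ell_1(chi z). Therefore
    exp(ell_r) extends to the entire function prod_chi E(chi z), with zeros at
    the points chi m for m a negative integer; its inverse has poles there,
    because a zero of finite order of a function is a pole of its inverse. *)

Set Implicit Arguments.
Unset Strict Implicit.
Unset Printing Implicit Defensive.
Import Order.TTheory GRing.Theory Num.Theory numFieldNormedType.Exports.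
Local Open Scope classical_set_scope.
Local Open Scope ring_scope.
Local Open Scope complex_scope.

(** * Modulus and limits of complex numbers *)

Section ComplexBasics.
Variable R : realType.
Local Notation C := (Cplx R).
Implicit Types (z w : C) (x y : R).

(** The norm of a complex number is itself a complex number. Its real
    counterpart serves for estimates and for comparison with real series. *)
Definition modulus z : R := Num.sqrt (complex.Re z ^+ 2 + complex.Im z ^+ 2).

Lemma normE z : `|z| = ofR (modulus z).
Proof. exact: normc_def. Qed.

Lemma ofRD x y : ofR (x + y) = ofR x + ofR y. Proof. exact: (rmorphD (real_complex R)). Qed.
Lemma ofRB x y : ofR (x - y) = ofR x - ofR y. Proof. exact: (rmorphB (real_complex R)). Qed.
Lemma ofRN x : ofR (- x) = - ofR x. Proof. exact: (rmorphN (real_complex R)). Qed.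
Lemma ofRM x y : ofR (x * y) = ofR x * ofR y. Proof. exact: (rmorphM (real_complex R)). Qed.
Lemma ofRV x : ofR x^-1 = (ofR x)^-1. Proof. exact: (fmorphV (real_complex R)). Qed.
Lemma ofRX x n : ofR (x ^+ n) = ofR x ^+ n. Proof. exact: (rmorphXn (real_complex R)). Qed.
Lemma ofR_nat n : ofR n%:R = n%:R :> C. Proof. exact: (rmorph_nat (real_complex R)). Qed.
Lemma ofR0 : ofR 0 = 0 :> C. Proof. by []. Qed.
Lemma ofR1 : ofR 1 = 1 :> C. Proof. by []. Qed.
Lemma ofR_sum (I : Type) (s : seq I) (P : pred I) (F : I -> R) :
  ofR (\sum_(i <- s | P i) F i) = \sum_(i <- s | P i) ofR (F i).
Proof. exact: (rmorph_sum (real_complex R)). Qed.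
Lemma ofR_le x y : (ofR x <= ofR y) = (x <= y). Proof. exact: lecR. Qed.
Lemma ofR_lt x y : (ofR x < ofR y) = (x < y). Proof. exact: ltcR. Qed.
Lemma ofR_inj : injective (@ofR R). Proof. exact: complexI. Qed.

Lemma ReD z w : complex.Re (z + w) = complex.Re z + complex.Re w.
Proof. by case: z; case: w. Qed.
Lemma ImD z w : complex.Im (z + w) = complex.Im z + complex.Im w.
Proof. by case: z; case: w. Qed.
Lemma ReN z : complex.Re (- z) = - complex.Re z. Proof. by case: z. Qed.
Lemma ImN z : complex.Im (- z) = - complex.Im z. Proof. by case: z. Qed.
Lemma ReM z w : complex.Re (z * w) =
  complex.Re z * complex.Re w - complex.Im z * complex.Im w.
Proof. by case: z; case: w. Qed.
Lemma ImM z w : complex.Im (z * w) =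
  complex.Re z * complex.Im w + complex.Im z * complex.Re w.
Proof. by case: z; case: w. Qed.
Lemma ReMr x z : complex.Re (ofR x * z) = x * complex.Re z.
Proof. by case: z => a b /=; rewrite mul0r subr0. Qed.
Lemma ImMr x z : complex.Im (ofR x * z) = x * complex.Im z.
Proof. by case: z => a b /=; rewrite mul0r addr0. Qed.

Lemma Cplx_eq z w : complex.Re z = complex.Re w -> complex.Im z = complex.Im w -> z = w.
Proof. by case: z => a b; case: w => c d /= -> ->. Qed.

Lemma modulus_ge0 z : 0 <= modulus z. Proof. exact: sqrtr_ge0. Qed.
Lemma modulusM z w : modulus (z * w) = modulus z * modulus w.
Proof. by apply: ofR_inj; rewrite ofRM -!normE normrM. Qed.
Lemma modulusX z n : modulus (z ^+ n) = modulus z ^+ n.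
Proof. by apply: ofR_inj; rewrite ofRX -!normE normrX. Qed.
Lemma modulusV z : modulus z^-1 = (modulus z)^-1.
Proof. by apply: ofR_inj; rewrite ofRV -!normE normfV. Qed.
Lemma modulusN z : modulus (- z) = modulus z.
Proof. by apply: ofR_inj; rewrite -!normE normrN. Qed.
Lemma modulusB z w : modulus (z - w) = modulus (w - z).
Proof. by rewrite -modulusN opprB. Qed.
Lemma modulusD z w : modulus (z + w) <= modulus z + modulus w.
Proof. by rewrite -ofR_le ofRD -!normE ler_normD. Qed.
Lemma modulus0 : modulus 0 = 0.
Proof. by apply: ofR_inj; rewrite -normE normr0. Qed.
Lemma modulus1 : modulus 1 = 1.
Proof. by apply: ofR_inj; rewrite -normE normr1. Qed.
Lemma modulus_eq0 z : (modulus z == 0) = (z == 0).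
Proof. by rewrite -(inj_eq ofR_inj) -normE normr_eq0. Qed.
Lemma modulus_gt0 z : (0 < modulus z) = (z != 0).
Proof. by rewrite lt_def modulus_ge0 andbT modulus_eq0. Qed.
Lemma modulus_ofR x : modulus (ofR x) = `|x|.
Proof. by rewrite /modulus /= expr0n addr0 sqrtr_sqr. Qed.
Lemma modulus_nat n : modulus n%:R = n%:R.
Proof. by rewrite -ofR_nat modulus_ofR normr_nat. Qed.
Lemma modulus_sum (I : Type) (s : seq I) (P : pred I) (F : I -> C) :
  modulus (\sum_(i <- s | P i) F i) <= \sum_(i <- s | P i) modulus (F i).
Proof.
apply: (big_ind2 (fun a b => modulus a <= b)) => //; first by rewrite modulus0.
by move=> a b c d h1 h2; apply: le_trans (modulusD _ _) (lerD h1 h2).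
Qed.
Lemma modulus_Re z : `|complex.Re z| <= modulus z.
Proof. by rewrite -sqrtr_sqr ler_wsqrtr// lerDl sqr_ge0. Qed.
Lemma modulus_Im z : `|complex.Im z| <= modulus z.
Proof. by rewrite -sqrtr_sqr ler_wsqrtr// lerDr sqr_ge0. Qed.
Lemma modulus_le z : modulus z <= `|complex.Re z| + `|complex.Im z|.
Proof.
have {1}-> : z = ofR (complex.Re z) + 'i%C * ofR (complex.Im z) by case: z => a b; apply: Cplx_eq;
  rewrite /= ; ring.
apply: le_trans (modulusD _ _) _; rewrite modulusM !modulus_ofR.
have -> : modulus 'i%C = 1 by rewrite /modulus /= expr0n add0r expr1n sqrtr1.
by rewrite mul1r.
Qed.

Lemma unit_discE z : unit_disc z <-> modulus z < 1.
Proof. by rewrite /unit_disc /= normE -ofR1 ofR_lt. Qed.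

(** In the topology of a numeric field the radii are complex; a positive radius
    is necessarily real. *)
Lemma cvgCP T (F : set_system T) {FF : Filter F} (f : T -> C) (l : C) :
  f @ F --> l <-> forall e : R, 0 < e -> \forall t \near F, modulus (f t - l) < e.
Proof.
split=> [/cvgrPdist_lt h e e0|h].
  have /h : 0 < ofR e by rewrite -ofR0 ofR_lt.
  by apply: filterS => t; rewrite normE ofR_lt modulusB.
apply/cvgrPdist_lt => e e0.
have ee : e = ofR (complex.Re e).
  by rewrite -[LHS](RRe_real (gtr0_real e0)).
have /h : 0 < complex.Re e by rewrite -ofR_lt -ee.
by apply: filterS => t; rewrite modulusB -ofR_lt -normE -ee.
Qed.

Lemma cvgC_modulus T (F : set_system T) {FF : Filter F} (f : T -> C) (l : C) :
  f @ F --> l <-> (fun t => modulus (f t - l)) @ F --> (0 : R).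
Proof.
rewrite cvgCP; split=> h.
  apply/cvgrPdist_lt => e /h; apply: filterS => t.
  by rewrite sub0r normrN ger0_norm ?modulus_ge0.
move=> e e0; move/cvgrPdist_lt : h => /(_ e e0); apply: filterS => t.
by rewrite sub0r normrN ger0_norm ?modulus_ge0.
Qed.

Lemma cvgC_ReIm T (F : set_system T) {FF : Filter F} (f : T -> C) (l : C) :
  f @ F --> l <-> ((fun t => complex.Re (f t)) @ F --> complex.Re l) /\
    ((fun t => complex.Im (f t)) @ F --> complex.Im l).
Proof.
rewrite cvgCP; split=> [h|[hr hi] e e0].
  split; apply/cvgrPdist_lt => e /h; apply: filterS => t /=; rewrite distrC.
    by rewrite -ReN -ReD; apply: le_lt_trans (modulus_Re _).
  by rewrite -ImN -ImD; apply: le_lt_trans (modulus_Im _).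
have e20 : 0 < e / 2 by rewrite divr_gt0.
move/cvgrPdist_lt : hr => /(_ _ e20); move/cvgrPdist_lt : hi => /(_ _ e20).
apply: filterS2 => t /= h1 h2; apply: le_lt_trans (modulus_le _) _.
rewrite ReD ReN ImD ImN distrC [`|complex.Im _ - _|]distrC.
by rewrite [e]splitr ltrD.
Qed.

Lemma cvg_ofR T (F : set_system T) {FF : Filter F} (f : T -> R) (l : R) :
  f @ F --> l -> (fun t => ofR (f t)) @ F --> ofR l.
Proof.
move=> fl; apply/cvgC_ReIm; split; first exact: fl.
exact: cvg_cst.
Qed.

Lemma cvgC_dominated T (F : set_system T) {FF : Filter F} (f : T -> C) (l : C)
    (g : T -> R) :
  (\forall t \near F, modulus (f t - l) <= g t) -> g @ F --> (0 : R) -> f @ F --> l.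
Proof.
move=> fg g0; apply/cvgC_modulus.
apply: (@squeeze_cvgr _ _ _ _ (fun=> 0) g) => //; last exact: cvg_cst.
by apply: filterS fg => t ->; rewrite modulus_ge0.
Qed.

Lemma cvg_modulus T (F : set_system T) {FF : Filter F} (f : T -> C) (l : C) :
  f @ F --> l -> (fun t => modulus (f t)) @ F --> modulus l.
Proof.
move/cvgC_modulus => h; apply/cvgrPdist_lt => e e0.
move/cvgrPdist_lt : h => /(_ e e0); apply: filterS => t.
rewrite sub0r normrN ger0_norm ?modulus_ge0//; apply: le_lt_trans.
rewrite ler_norml; apply/andP; split.
  by rewrite lerNl opprB lerBlDr; rewrite -{1}[f t](subrK l) modulusD.
by rewrite lerBlDr -{1}[l](subrK (f t)) [modulus (f t - l)]modulusB modulusD.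
Qed.

Lemma near_discC (p : C) (P : C -> Prop) :
  (\forall z \near p, P z) <-> exists2 e : R, 0 < e & forall z, modulus (z - p) < e -> P z.
Proof.
split=> [|[e e0 h]].
  move/(nbhs_normP p) => [e /= e0 h].
  have ee : e = ofR (complex.Re e).
    by rewrite -[LHS](RRe_real (gtr0_real e0)).
  exists (complex.Re e); first by rewrite -ofR_lt -ee.
  by move=> z zp; apply: h; rewrite /= normE modulusB ee ofR_lt.
apply/(nbhs_normP p); exists (ofR e); first by rewrite /= -ofR0 ofR_lt.
by move=> z /=; rewrite normE ofR_lt modulusB; apply: h.
Qed.

(** Completeness of the complex plane, for dominated series: the real and
    imaginary parts converge absolutely. *)
Lemma cvg_seriesC (u : C^nat) (b : R^nat) :
  (forall n, modulus (u n) <= b n) -> cvgn (series b) -> cvgn (series u).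
Proof.
move=> ub cb.
have cRe : cvgn (series (fun n => complex.Re (u n))).
  apply: normed_cvg; apply: series_le_cvg cb => n /=; first exact: normr_ge0.
    exact: le_trans (modulus_ge0 _) (ub n).
  exact: le_trans (modulus_Re _) (ub n).
have cIm : cvgn (series (fun n => complex.Im (u n))).
  apply: normed_cvg; apply: series_le_cvg cb => n /=; first exact: normr_ge0.
    exact: le_trans (modulus_ge0 _) (ub n).
  exact: le_trans (modulus_Im _) (ub n).
have sE (pr : C -> R) (hD : forall z w, pr (z + w) = pr z + pr w) (h0 : pr 0 = 0) :
    pr \o series u = series (pr \o u).
  by apply/funext => n; rewrite /series /=; apply: (big_morph pr).
apply/cvg_ex; exists (limn (series (fun n => complex.Re (u n))) +i* limn (series
  (fun n => complex.Im (u n)))).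
apply/cvgC_ReIm; split => /=.
  by rewrite -[X in X @ _ --> _]/((fun z : C => complex.Re z) \o series u) sE//; exact: ReD.
by rewrite -[X in X @ _ --> _]/((fun z : C => complex.Im z) \o series u) sE//; exact: ImD.
Qed.

Lemma modulus_lim_series_le (u : C^nat) (b : R^nat) :
  (forall n, modulus (u n) <= b n) -> cvgn (series b) ->
  modulus (limn (series u)) <= limn (series b).
Proof.
move=> ub cb; have cu := cvg_seriesC ub cb.
have h : (fun t => modulus (series u t)) @ \oo --> modulus (limn (series u)).
  by apply: cvg_modulus; exact: cu.
rewrite -(cvg_lim _ h)//; apply: ler_lim => //; first by apply/cvg_ex; eexists; exact: h.
by apply: nearW => n; rewrite /series /=; apply: le_trans (modulus_sum _ _ _) _; apply: ler_sum.
Qed.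

End ComplexBasics.

(** * Complex derivatives and the exponential *)

(** The first-order expansion with an explicit error, including the increment 0,
    is what termwise estimates of power series produce. *)
Lemma is_derive1P (K : numFieldType) (f : K -> K) (x d : K) :
  is_derive x 1 f d <->
  forall e, 0 < e -> \forall h \near 0, `|f (x + h) - f x - h * d| <= e * `|h|.
Proof.
split=> [[fx fd] e e0|h].
  have : (fun h => h^-1 *: (f (h *: 1 + x) - f x)) @ 0^' --> d.
    by rewrite -fd; exact: fx.
  move/cvgrPdist_lt => /(_ e e0).
  rewrite /dnbhs near_withinE; apply: filterS => h hP.
  have [->|h0] := eqVneq h 0; first by rewrite addr0 subrr mul0r subr0 !normr0 mulr0.
  have := hP h0; rewrite /GRing.scale /= mulr1 => /ltW.
  rewrite -(ler_pM2r (_ : 0 < `|h|)) ?normr_gt0// => /(le_trans _); apply.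
  rewrite -normrM distrC mulrBl; rewrite [X in _ <= `|_ - X|]mulrAC mulVf// mul1r distrC.
  by rewrite [h + x]addrC [d * h]mulrC distrC.
suff fd : (fun h => h^-1 *: (f (h *: 1 + x) - f x)) @ 0^' --> d.
  by apply: DeriveDef; [apply/cvg_ex; exists d|exact: cvg_lim fd].
apply/cvgrPdist_le => e /h.
rewrite /dnbhs near_withinE; apply: filterS => k hk k0.
rewrite /GRing.scale /= mulr1 -(ler_pM2r (_ : 0 < `|k|)) ?normr_gt0//.
apply: le_trans hk; rewrite -normrM distrC mulrBl mulrAC mulVf// mul1r.
by rewrite [k + x]addrC [d * k]mulrC.
Qed.

Lemma is_derive_compK (K : numFieldType) (f g : K -> K) (z df dg : K) :
  is_derive z 1 f df -> is_derive (f z) 1 g dg ->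
  is_derive z 1 (fun t => g (f t)) (dg * df).
Proof.
move=> [hf1 hf2] [hg1 hg2].
move/derivable1_diffP in hf1; move/derivable1_diffP in hg1.
have hgf : differentiable (g \o f) z by exact: differentiable_comp.
apply: DeriveDef; first exact/derivable1_diffP.
change ('D_1 (g \o f) z = dg * df).
rewrite deriveE// diff_comp//=.
have e1 : 'd f z 1 = df by rewrite -deriveE.
have e2 : 'd g (f z) 1 = dg by rewrite -deriveE.
apply: (etrans (congr1 ('d g (f z)) e1)).
have e3 : df = df *: (1 : K) by rewrite /GRing.scale /= mulr1.
apply: (etrans (congr1 ('d g (f z)) e3)).
apply: (etrans (linearZZ ('d g (f z)) df 1)).
apply: (etrans (congr1 ( *:%R df) e2)).
exact: mulrC.
Qed.

Section Cexp.
Variable R : realType.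
Local Notation C := (Cplx R).
Implicit Types (z w : C) (x y : R).

Lemma is_deriveCP (f : C -> C) z d :
  is_derive z 1 f d <->
  forall e : R, 0 < e -> exists2 del : R, 0 < del &
    forall h : C, modulus h < del -> modulus (f (z + h) - f z - h * d) <= e * modulus h.
Proof.
rewrite is_derive1P; split=> [h e e0|h e e0].
  have /h/near_discC[del d0 hd] : 0 < ofR e by rewrite -ofR0 ofR_lt.
  exists del => // k kd; have := hd k; rewrite subr0 => /(_ kd).
  by rewrite !normE -ofRM ofR_le.
have ee : e = ofR (complex.Re e) by rewrite -[LHS](RRe_real (gtr0_real e0)).
have /h[del d0 hd] : 0 < complex.Re e by rewrite -ofR_lt -ee.
apply/near_discC; exists del => // k; rewrite subr0 => /hd.
by rewrite !normE ee -ofRM ofR_le.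
Qed.

Lemma is_deriveRP (f : R -> R) x d :
  is_derive x 1 f d <->
  forall e : R, 0 < e -> exists2 del : R, 0 < del &
    forall h : R, `|h| < del -> `|f (x + h) - f x - h * d| <= e * `|h|.
Proof.
rewrite is_derive1P; split=> [h e /h /nbhs_normP[del /= d0 hd]|h e e0].
  by exists del => // k kd; apply: hd; rewrite /= sub0r normrN.
have [del d0 hd] := h _ e0.
by apply/nbhs_normP; exists del => // k; rewrite /= sub0r normrN => /hd.
Qed.

Lemma cexp0 : cexp (0 : C) = 1.
Proof. by rewrite /cexp /= expR0 cos0 sin0 mul1r. Qed.

Lemma cexpD z w : cexp (z + w) = cexp z * cexp w.
Proof.
rewrite /cexp ReD ImD expRD cosD sinD; apply: Cplx_eq; rewrite !(ReM, ImM) /=; ring.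
Qed.

Lemma cexp_neq0 z : cexp z != 0.
Proof.
apply/eqP => h; have : cexp z * cexp (- z) = 1 by rewrite -cexpD subrr cexp0.
by rewrite h mul0r => /eqP; rewrite eq_sym oner_eq0.
Qed.

Lemma cexpN z : cexp (- z) = (cexp z)^-1.
Proof.
apply: (mulrI (_ : cexp z \is a GRing.unit)); last first.
  rewrite -cexpD subrr cexp0 divff//.
  exact: cexp_neq0.
by rewrite unitfE cexp_neq0.
Qed.

Lemma cexp_sum (I : Type) (s : seq I) (P : pred I) (F : I -> C) :
  cexp (\sum_(i <- s | P i) F i) = \prod_(i <- s | P i) cexp (F i).
Proof. by apply: (big_morph (@cexp R)); [exact: cexpD|exact: cexp0]. Qed.

Lemma modulus_cexp z : modulus (cexp z) = expR (complex.Re z).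
Proof.
rewrite /cexp modulusM modulus_ofR ger0_norm ?expR_ge0// /modulus /= cos2Dsin2 sqrtr1 mulr1 //.
Qed.

(** By the functional equation it is enough to expand at 0, where the real and
    imaginary parts of e^h - 1 - h are estimated through the first-order
    expansions of exp, sin and cos. *)
Lemma is_derive_cexp z : is_derive z 1 (@cexp R) (cexp z).
Proof.
apply/is_deriveCP => e e0.
pose M := modulus (cexp z); have M0 : 0 < M by rewrite modulus_gt0 cexp_neq0.
(* Four estimates below add up to 8 eps |h|. *)
pose eps := Num.min 1 (e / (8 * M)).
have eps0 : 0 < eps by rewrite lt_min ltr01 divr_gt0// mulr_gt0.
have eps1 : eps <= 1 by rewrite ge_min lexx.
have epsM : 8 * eps * M <= e.
  have : eps <= e / (8 * M) by rewrite ge_min lexx orbT.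
  by rewrite ler_pdivlMr ?mulr_gt0// => h; apply: le_trans h; rewrite mulrCA mulrA.
clearbody eps.
have [d1 d10 h1] := (is_deriveRP expR 0 1).1 (is_derive_eq (is_derive_expR 0) (expR0 R)) _ eps0.
have [d2 d20 h2] := (is_deriveRP sin 0 1).1 (is_derive_eq (is_derive_sin 0) (cos0 R)) _ eps0.
have [d3 d30 h3] := (is_deriveRP cos 0 0).1 (is_derive_eq (is_derive_cos 0) (etrans (congr1 -%R
  (sin0 R)) (oppr0 R))) _ eps0.
exists (Num.min eps (Num.min d1 (Num.min d2 d3))); first by rewrite !lt_min eps0 d10 d20 d30.
move=> h; rewrite !lt_min => /and4P[he hd1 hd2 hd3].
have -> : cexp (z + h) - cexp z - h * cexp z = cexp z * (cexp h - 1 - h).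
  by rewrite cexpD; ring.
rewrite modulusM -/M; set a := complex.Re h; set b := complex.Im h.
have ah : `|a| <= modulus h := modulus_Re h.
have bh : `|b| <= modulus h := modulus_Im h.
have {h1} := h1 a (le_lt_trans ah hd1); rewrite add0r expR0 mulr1 => h1.
have {h2} := h2 b (le_lt_trans bh hd2); rewrite add0r sin0 subr0 mulr1 => h2.
have {h3} := h3 b (le_lt_trans bh hd3); rewrite add0r cos0 mulr0 subr0 => h3.
suff : modulus (cexp h - 1 - h) <= 8 * eps * modulus h.
  move=> k; apply: (le_trans (ler_wpM2l (ltW M0) k)).
  by rewrite mulrA [M * _]mulrC ler_wpM2r// modulus_ge0.
apply: le_trans (modulus_le _) _; rewrite !(ReD, ImD, ReN, ImN) /cexp ReMr ImMr /= -/a -/b.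
have -> : expR a * cos b - 1 - a = (expR a - 1 - a) * cos b + (1 + a) * (cos b - 1) by ring.
have -> : expR a * sin b - 0 - b = (expR a - 1) * sin b + (sin b - b) by ring.
have m0 := modulus_ge0 h.
have t1 : `|(expR a - 1 - a) * cos b| <= eps * modulus h.
  rewrite normrM -[leRHS]mulr1; apply: ler_pM => //.
    by apply: le_trans h1 _; rewrite ler_wpM2l// ltW.
  by rewrite ler_norml cos_geN1 cos_le1.
have t2 : `|(1 + a) * (cos b - 1)| <= 2 * (eps * modulus h).
  rewrite normrM; apply: ler_pM => //.
    by apply: le_trans (ler_normD _ _) _; rewrite normr1; lra.
  by apply: le_trans h3 _; rewrite ler_wpM2l// ltW.
have t3 : `|expR a - 1| <= 2 * eps.
  have -> : expR a - 1 = (expR a - 1 - a) + a by ring.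
  apply: le_trans (ler_normD _ _) _; rewrite mulr_natl mulr2n.
  have ae : `|a| <= eps by apply: le_trans ah (ltW he).
  apply: lerD => //; apply: le_trans h1 _; rewrite -[leRHS]mulr1 ler_wpM2l ?(ltW eps0)//.
  exact: le_trans ae eps1.
have t4 : `|sin b| <= 2 * modulus h.
  have -> : sin b = (sin b - b) + b by ring.
  apply: le_trans (ler_normD _ _) _; rewrite mulr_natl mulr2n.
  apply: lerD => //; apply: le_trans h2 _; rewrite -[leRHS]mul1r.
  by apply: ler_pM => //; apply: ltW.
have t5 : `|(expR a - 1) * sin b| <= 4 * (eps * modulus h).
  rewrite normrM (_ : 4 * _ = (2 * eps) * (2 * modulus h)); last by ring.
  exact: ler_pM.
have t6 : `|sin b - b| <= eps * modulus h.
  by apply: le_trans h2 _; rewrite ler_wpM2l// ltW.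
have := ler_normD ((expR a - 1 - a) * cos b) ((1 + a) * (cos b - 1)).
have := ler_normD ((expR a - 1) * sin b) (sin b - b).
lra.
Qed.

Lemma is_derive_continuousC (f : C -> C) z d : is_derive z 1 f d -> f y @[y --> z] --> f z.
Proof.
move=> fd; apply: differentiable_continuous; apply/derivable1_diffP; exact: ex_derive.
Qed.

Lemma cvg_cexp T (F : set_system T) {FF : Filter F} (f : T -> C) (l : C) :
  f @ F --> l -> (fun t => cexp (f t)) @ F --> cexp l.
Proof.
have c : {for l, continuous (@cexp R)} := is_derive_continuousC (is_derive_cexp l).
exact: continuous_cvg c.
Qed.

Lemma is_deriveC_D (f g : C -> C) z df dg :
  is_derive z 1 f df -> is_derive z 1 g dg -> is_derive z 1 (fun t => f t + g t) (df + dg).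
Proof. by move=> hf hg; exact: is_deriveD. Qed.
Lemma is_deriveC_M (f g : C -> C) z df dg :
  is_derive z 1 f df -> is_derive z 1 g dg ->
  is_derive z 1 (fun t => f t * g t) (df * g z + f z * dg).
Proof.
move=> hf hg; apply: (is_derive_eq (is_deriveM hf hg)). rewrite /GRing.scale /=. ring.
Qed.
Lemma is_deriveC_comp (f g : C -> C) z df dg :
  is_derive z 1 f df -> is_derive (f z) 1 g dg ->
  is_derive z 1 (fun t => g (f t)) (dg * df).
Proof. exact: is_derive_compK. Qed.
Lemma is_deriveC_scale (k z : C) : is_derive z 1 (fun t => k * t) k.
Proof.
apply: (is_derive_eq (is_deriveC_M (is_derive_cst k z 1) (is_derive_id z 1))).
by rewrite mul0r add0r mulr1.
Qed.
End Cexp.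

(** * Power series with bounded coefficients *)

Section PowerSeries.
Variable R : realType.
Local Notation C := (Cplx R).
Implicit Types (z w : C) (x y : R).

Lemma cvgC_lim (u : C^nat) (l : C) : u @ \oo --> l -> limn u = l.
Proof. by move=> h; apply: cvg_lim. Qed.

Lemma nneg_bounded_series (a : R^nat) (B : R) : (forall k, 0 <= a k) ->
  (forall n, series a n <= B) -> cvgn (series a).
Proof.
move=> a0 aB; apply: nondecreasing_is_cvgn.
  by apply/nondecreasing_seqP => n; rewrite /series /= big_nat_recr//= lerDl.
by exists B => _ [n _ <-].
Qed.

(** Summing the recursion gives A(n+1) = rho A(n) + B(n) for the partial sums,
    so the bound B / (1 - rho) propagates. Two applications bound the series
    that dominate the derivative of a power series and its second-order
    remainder. *)
Lemma recur_series_le (a b : R^nat) (rho B : R) : 0 <= rho < 1 ->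
  (forall k, 0 <= a k) -> a 0%N = 0 -> (forall k, a k.+1 = rho * a k + b k) ->
  (forall n, series b n <= B) -> 0 <= B -> forall n, series a n <= B / (1 - rho).
Proof.
move=> /andP[r0 r1] a0 a00 ab bB B0.
have r1' : 0 < 1 - rho by rewrite subr_gt0.
have rec n : series a n.+1 = rho * series a n + series b n.
  rewrite /series /= big_nat_recl//= a00 add0r mulr_sumr -big_split /=.
  by apply: eq_bigr => i _; rewrite ab.
elim=> [|n IH]; first by rewrite /series /= big_geq// divr_ge0// ltW.
rewrite rec; apply: le_trans (lerD (ler_wpM2l r0 IH) (bB n)) _.
rewrite -{2}[B](divfK (lt0r_neq0 r1')) le_eqVlt; apply/orP; left; apply/eqP; ring.
Qed.

(** In closed form this is k (k-1)/2 rho^(k-2); the recursion is the one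
    satisfied by the remainder in [taylor2_le]. *)
Fixpoint taylor_majorant (rho : R) (k : nat) : R :=
  if k is k'.+1 then rho * taylor_majorant rho k' + k'%:R * rho ^+ k'.-1 else 0.

Lemma geometric_series_le (rho : R) : 0 <= rho < 1 -> forall n, series (fun k => rho ^+ k) n <=
  (1 - rho)^-1.
Proof.
move=> /andP[r0 r1] n; have r1' : 0 < 1 - rho by rewrite subr_gt0.
rewrite -[leRHS]mul1r ler_pdivlMr//.
have -> : series (fun k => rho ^+ k) n * (1 - rho) = 1 - rho ^+ n.
  rewrite /series /=; elim: n => [|n IH]; first by rewrite big_geq// mul0r expr0 subrr.
  by rewrite big_nat_recr//= mulrDl IH exprS; ring.
by rewrite gerBl exprn_ge0.
Qed.

Lemma taylor_majorant_ge0 (rho : R) k : 0 <= rho -> 0 <= taylor_majorant rho k.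
Proof.
by move=> r0; elim: k => //= k IH; rewrite addr_ge0// mulr_ge0// exprn_ge0.
Qed.

Lemma derived_geometric_series_le (rho : R) : 0 <= rho < 1 ->
  forall n, series (fun k => k%:R * rho ^+ k.-1) n <= (1 - rho)^-1 / (1 - rho).
Proof.
move=> rr; have /andP[r0 r1] := rr; have r1' : 0 < 1 - rho by rewrite subr_gt0.
apply: (@recur_series_le _ (fun k => rho ^+ k)) => //.
- by move=> k; rewrite mulr_ge0// exprn_ge0.
- by rewrite mul0r.
- move=> [|k] /=; first by rewrite expr0 !mul0r mulr0 add0r mulr1.
  by rewrite -natr1 exprS; ring.
- exact: geometric_series_le.
- by rewrite invr_ge0 ltW.
Qed.

Lemma taylor_majorant_series_le (rho : R) : 0 <= rho < 1 ->
  forall n, series (taylor_majorant rho) n <= (1 - rho)^-1 / (1 - rho) / (1 - rho).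
Proof.
move=> rr; have /andP[r0 r1] := rr; have r1' : 0 < 1 - rho by rewrite subr_gt0.
apply: (@recur_series_le _ (fun k => k%:R * rho ^+ k.-1)) => //.
- by move=> k; exact: taylor_majorant_ge0.
- exact: derived_geometric_series_le.
- by rewrite divr_ge0 ?invr_ge0 ?(ltW r1').
Qed.

(** Induction on k, from e_(k+1) = (z + h) e_k + h^2 k z^(k-1) for the
    remainders e_k. *)
Lemma taylor2_le (rho : R) z h k : modulus z <= rho -> modulus (z + h) <= rho ->
  modulus ((z + h) ^+ k - z ^+ k - h * (k%:R * z ^+ k.-1)) <= modulus h ^+ 2 * taylor_majorant rho
    k.
Proof.
move=> zr zhr; have r0 : 0 <= rho by apply: le_trans zr; exact: modulus_ge0.
elim: k => [|k IH]; first by rewrite !expr0 subrr mul0r mulr0 subrr modulus0 mulr0.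
have -> : (z + h) ^+ k.+1 - z ^+ k.+1 - h * (k.+1%:R * z ^+ k.+1.-1) =
  (z + h) * ((z + h) ^+ k - z ^+ k - h * (k%:R * z ^+ k.-1)) + h ^+ 2 * (k%:R * z ^+ k.-1).
  case: k {IH} => [|k] /=; first by rewrite !expr0 expr1; ring.
  by rewrite -[k.+2%:R]natr1 !exprS; ring.
apply: le_trans (modulusD _ _) _; rewrite [taylor_majorant _ _.+1]/= [in leRHS]mulrDr; apply: lerD.
  by rewrite modulusM [leRHS]mulrCA; apply: ler_pM => //; exact: modulus_ge0.
rewrite !modulusM !modulusX modulus_nat ler_wpM2l ?sqr_ge0// ler_wpM2l//.
by rewrite lerXn2r ?nnegrE ?modulus_ge0.
Qed.

Definition psum (c : nat -> C) z : C := limn (series (fun k => c k * z ^+ k)).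

Lemma psum_cvg (c : nat -> C) B z : (forall k, modulus (c k) <= B) -> modulus z < 1 ->
  cvgn (series (fun k => c k * z ^+ k)).
Proof.
move=> cB z1.
have rr : 0 <= modulus z < 1 by rewrite modulus_ge0.
have B0 : 0 <= B by apply: le_trans (cB 0%N); exact: modulus_ge0.
apply: (@cvg_seriesC _ _ (B *: (fun k => modulus z ^+ k))).
  by move=> n; rewrite modulusM modulusX; apply: ler_wpM2r (cB n); rewrite exprn_ge0 ?modulus_ge0.
apply: is_cvg_seriesZ; apply: nneg_bounded_series (geometric_series_le rr) => k.
by rewrite exprn_ge0// modulus_ge0.
Qed.

(** Termwise differentiation: the remainders of the powers z^k are at most |h|^2
    times a summable sequence, uniformly on the disc of radius (1 + |z|)/2. *)
Lemma psum_is_derive (c : nat -> C) B z : (forall k, modulus (c k) <= B) -> modulus z < 1 ->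
  is_derive z 1 (psum c) (limn (series (fun k => c k * (k%:R * z ^+ k.-1)))).
Proof.
move=> cB z1; have z0 := modulus_ge0 z.
have B0 : 0 <= B by apply: le_trans (cB 0%N); exact: modulus_ge0.
pose rho := (1 + modulus z) / 2.
have rr : 0 <= rho < 1 by rewrite /rho; apply/andP; split; lra.
have zr : modulus z <= rho by rewrite /rho; lra.
have /andP[r0 r1] := rr; have r1' : 0 < 1 - rho by rewrite subr_gt0.
set W := (1 - rho)^-1 / (1 - rho) / (1 - rho).
have W0 : 0 <= W by rewrite /W !divr_ge0 ?invr_ge0// ltW.
have cvw : cvgn (series (taylor_majorant rho)).
  by apply: nneg_bounded_series (taylor_majorant_series_le rr) => k; exact: taylor_majorant_ge0.
have cvd : cvgn (series (fun k => c k * (k%:R * z ^+ k.-1))).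
  apply: (@cvg_seriesC _ _ (B *: (fun k => k%:R * rho ^+ k.-1))).
    move=> n; rewrite !modulusM modulusX modulus_nat; apply: ler_pM => //.
    - exact: modulus_ge0.
    - by rewrite mulr_ge0// exprn_ge0.
    - by rewrite ler_wpM2l// lerXn2r ?nnegrE.
  apply: is_cvg_seriesZ; apply: nneg_bounded_series (derived_geometric_series_le rr) => k.
  by rewrite mulr_ge0// exprn_ge0.
apply/is_deriveCP => e e0.
have BW0 : 0 < B * W + 1 by rewrite ltr_wpDl// mulr_ge0.
(* B W bounds the quotient of the total remainder by |h|^2. *)
exists (Num.min (rho - modulus z) (e / (B * W + 1))).
  by rewrite lt_min (divr_gt0 e0 BW0) andbT /rho; lra.
move=> h; rewrite lt_min => /andP[h1 h2].
have zhr : modulus (z + h) <= rho by apply: le_trans (modulusD _ _) _; lra.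
have zh1 : modulus (z + h) < 1 by apply: le_lt_trans zhr r1.
pose d := fun k => c k * ((z + h) ^+ k - z ^+ k - h * (k%:R * z ^+ k.-1)).
have dle k : modulus (d k) <= (B * modulus h ^+ 2) * taylor_majorant rho k.
  by rewrite modulusM -mulrA ler_pM ?modulus_ge0// taylor2_le.
have -> : psum c (z + h) - psum c z - h * limn (series (fun k => c k * (k%:R * z ^+ k.-1)))
    = limn (series d).
  apply/esym/cvgC_lim.
  have -> : series d = (fun n => series (fun k => c k * (z + h) ^+ k) n
     - series (fun k => c k * z ^+ k) n - h * series (fun k => c k * (k%:R * z ^+ k.-1)) n).
    apply/funext => n; rewrite /series /= mulr_sumr -!sumrB.
    by apply: eq_bigr => k _; rewrite /d; ring.
  apply: cvgB; last by apply: cvgMr; exact: cvd.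
  by apply: cvgB; exact: psum_cvg cB _.
have cvb : cvgn (series ((B * modulus h ^+ 2) *: taylor_majorant rho)) by exact: is_cvg_seriesZ.
apply: (le_trans (modulus_lim_series_le dle cvb)).
rewrite lim_seriesZ// /GRing.scale /=.
have lW : limn (series (taylor_majorant rho)) <= W.
  by apply: limr_le => //; apply: nearW => n; exact: taylor_majorant_series_le.
apply: (@le_trans _ _ (B * modulus h ^+ 2 * W)).
  by rewrite ler_wpM2l// mulr_ge0// exprn_ge0 ?modulus_ge0.
rewrite mulrAC expr2 mulrA ler_wpM2r ?modulus_ge0//.
move: h2; rewrite ltr_pdivlMr// => h2.
apply: le_trans (ltW h2); rewrite [leLHS]mulrC ler_wpM2l ?modulus_ge0//; lra.
Qed.

(** The real variable enters through the real and imaginary parts of a function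
    along a line; [pr] stands for either of them. *)
Lemma is_derive_line (pr : C -> R) (f : C -> C) w (t : R) (d : C) :
  (forall z1 z2, pr (z1 + z2) = pr z1 + pr z2) -> (forall z, `|pr z| <= modulus z) ->
  (forall x z, pr (ofR x * z) = x * pr z) ->
  is_derive (ofR t * w) 1 f d -> is_derive t 1 (fun t => pr (f (ofR t * w))) (pr (w * d)).
Proof.
move=> prD prle prZ /is_deriveCP fd; apply/is_deriveRP => e e0.
have w1 : 0 < modulus w + 1 by rewrite ltr_wpDl// modulus_ge0.
have [del d0 hd] := fd (e / (modulus w + 1)) (divr_gt0 e0 w1).
exists (del / (modulus w + 1)); first exact: divr_gt0.
move=> k; rewrite ltr_pdivlMr// => kd.
have prN z : pr (- z) = - pr z.
  by rewrite -[- z]mulN1r -ofR1 -ofRN prZ mulN1r.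
rewrite -prZ ofRD mulrDl -!prN -!prD; apply: le_trans (prle _) _.
have kw : modulus (ofR k * w) < del.
  apply: le_lt_trans kd; rewrite modulusM modulus_ofR ler_wpM2l//; lra.
rewrite mulrA; apply: le_trans (hd _ kw) _.
rewrite modulusM modulus_ofR -mulrA ler_wpM2l ?(ltW e0)//.
rewrite mulrC ler_pdivrMr// ler_wpM2l//; lra.
Qed.

(** The mean value theorem, applied to the real and imaginary parts of f along
    the segment from 0 to z. *)
Lemma disc_const (f : C -> C) : (forall z, modulus z < 1 -> is_derive z 1 f 0) ->
  forall z, modulus z < 1 -> f z = f 0.
Proof.
move=> f0 w w1.
have key (pr : C -> R) :
  (forall z1 z2, pr (z1 + z2) = pr z1 + pr z2) -> (forall z, `|pr z| <= modulus z) ->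
  (forall x z, pr (ofR x * z) = x * pr z) -> pr (f w) = pr (f 0).
  move=> prD prle prZ.
  have pr0 : pr 0 = 0 by rewrite -[0 in LHS](mul0r 0) -ofR0 prZ mul0r.
  have D (t : R) : t \in `[0, 1]%R -> is_derive t 1 (fun t => pr (f (ofR t * w))) 0.
    rewrite in_itv /= => /andP[t0 t1].
    have tw : modulus (ofR t * w) < 1.
      by rewrite modulusM modulus_ofR ger0_norm//; apply: le_lt_trans w1;
        rewrite ler_piMl ?modulus_ge0.
    apply: (is_derive_eq (is_derive_line prD prle prZ (f0 _ tw))).
    by rewrite mulr0.
  pose phi (t : R) : R := pr (f (ofR t * w)).
  have H1 (t : R) : t \in `]0, 1[%R -> is_derive t 1 phi 0.
    by move=> t01; apply: D; exact: subset_itv_oo_cc.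
  have H2 : {within `[0, 1], continuous phi}.
    by apply: derivable_within_continuous => t /D h; exact: ex_derive.
  have [c _] := MVT_segment ler01 H1 H2.
  by rewrite mul0r /phi => /eqP; rewrite subr_eq0 ofR0 ofR1 mul1r mul0r => /eqP.
apply: Cplx_eq.
  by apply: (key (fun z => complex.Re z)); [exact: ReD|exact: modulus_Re|exact: ReMr].
by apply: (key (fun z => complex.Im z)); [exact: ImD|exact: modulus_Im|exact: ImMr].
Qed.

End PowerSeries.

(** * Logarithms of infinite products *)

Section LogSeries.
Variable R : realType.
Local Notation C := (Cplx R).
Implicit Types (z w u : C) (x y : R).

Definition log1p_coef (k : nat) : C := if k is 0 then 0 else - ((-1) ^+ k / k%:R).

Definition log1p w := psum log1p_coef w.

Lemma log1p_coef_le k : modulus (log1p_coef k) <= 1.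
Proof.
case: k => [|k]; first by rewrite modulus0.
rewrite modulusN modulusM modulusX modulusN modulus1 expr1n mul1r modulusV modulus_nat.
by rewrite invf_le1// ler1n.
Qed.

Lemma psum0 (c : nat -> C) : psum c 0 = c 0%N.
Proof.
apply: cvgC_lim; apply: cvg_near_cst; near=> n.
have n0 : (0 < n)%N by near: n; exact: nbhs_infty_gt.
rewrite /series /= -(prednK n0) big_nat_recl//= expr0 mulr1 big1 ?addr0// => i _.
by rewrite expr0n mulr0.
Unshelve. all: by end_near. Qed.

Lemma cvgC_expr w : modulus w < 1 -> (fun n => w ^+ n) @ \oo --> (0 : C).
Proof.
move=> w1; apply/cvgC_modulus.
under eq_fun do rewrite subr0 modulusX.
by apply: cvg_expr; rewrite ger0_norm ?modulus_ge0.
Qed.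

(** The derived series is geometric, with ratio -w. *)
Lemma is_derive_log1p w : modulus w < 1 -> is_derive w 1 log1p (1 + w)^-1.
Proof.
move=> w1; apply: (is_derive_eq (psum_is_derive log1p_coef_le w1)).
apply: cvgC_lim.
have H : (fun n => (1 + w)^-1 * (1 - (- w) ^+ n)) @ \oo --> (1 + w)^-1.
  rewrite -[X in _ --> X]mulr1; apply: cvgMr; rewrite -[X in _ --> X]subr0.
  apply: cvgB; first exact: cvg_cst.
  by apply: cvgC_expr; rewrite modulusN.
rewrite -cvg_shiftS.
have w0 : 1 + w != 0.
  apply/eqP => h; move: w1; have -> : w = -1 by apply/eqP; rewrite -subr_eq0 opprK addrC h.
  by rewrite modulusN modulus1 ltxx.
have -> : (fun n => series (fun k => log1p_coef k * (k%:R * w ^+ k.-1)) n.+1) =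
    (fun n => (1 + w)^-1 * (1 - (- w) ^+ n)).
  apply/funext => n; rewrite /series /= big_nat_recl//= mul0r add0r.
  apply: (mulfI w0); rewrite mulrA divff// mul1r.
  elim: n => [|n IH]; first by rewrite big_geq// mulr0 expr0 subrr.
  rewrite big_nat_recr//= mulrDr IH.
  have -> : - ((-1) ^+ n.+1 / n.+1%:R) * (n.+1%:R * w ^+ n) = (- w) ^+ n.
    have n0 : n.+1%:R != 0 :> C by rewrite pnatr_eq0.
    rewrite -[- w]mulN1r exprMn exprS; move: (n.+1%:R) n0 => k k0; by field.
  by rewrite exprS; ring.
exact: H.
Qed.

(** The derivative of e^(- log1p w) (1 + w) vanishes. *)
Lemma cexp_log1p w : modulus w < 1 -> cexp (log1p w) = 1 + w.
Proof.
move=> w1.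
have D z : modulus z < 1 -> is_derive z 1 (fun t => cexp (- 1 * log1p t) * (1 + t)) 0.
  move=> z1.
  have d1 := is_deriveC_comp (is_deriveC_comp (is_derive_log1p z1) (is_deriveC_scale (-1) _))
    (is_derive_cexp _).
  have d2 := is_deriveC_D (is_derive_cst (1 : C) z 1) (is_derive_id z 1).
  apply: (is_derive_eq (is_deriveC_M d1 d2)).
  have z0 : 1 + z != 0.
    apply/eqP => h; move: z1; have -> : z = -1 by apply/eqP; rewrite -subr_eq0 opprK addrC h.
    by rewrite modulusN modulus1 ltxx.
  rewrite /cst /= add0r mulr1 mulrA divfK//; ring.
have := disc_const D w1; rewrite /log1p psum0 /= mulr0 cexp0 mul1r addr0 mulN1r cexpN => h.
have := congr1 (fun t => cexp (psum log1p_coef w) * t) h.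
by rewrite mulrA divff ?cexp_neq0// mul1r mulr1.
Qed.

(** When [s k] is the power sum of the x_n^k, these are the coefficients of
    sum_n (log(1 + x_n u) - x_n u); the cut at k = 2 removes the linear
    terms. *)
Definition log_prod_coef (s : nat -> R) (k : nat) : C := if (k < 2)%N then 0 else log1p_coef k * ofR
  (s k).

Lemma log_prod_coef_le (s : nat -> R) B : (forall k, (2 <= k)%N -> `|s k| <= B) ->
  forall k, modulus (log_prod_coef s k) <= B.
Proof.
move=> sB k; have B0 : 0 <= B by apply: le_trans (sB 2%N isT).
rewrite /log_prod_coef; case: ltnP => k2; first by rewrite modulus0.
by rewrite modulusM modulus_ofR -[leRHS]mul1r ler_pM ?modulus_ge0 ?log1p_coef_le ?sB.
Qed.

Lemma psum_log_prod_coefB s t Bs Bt u : (forall k, (2 <= k)%N -> `|s k| <= Bs) ->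
  (forall k, (2 <= k)%N -> `|t k| <= Bt) -> modulus u < 1 ->
  psum (log_prod_coef s) u - psum (log_prod_coef t) u = psum (log_prod_coef (fun k => s k - t k)) u.
Proof.
move=> sB tB u1; apply/esym/cvgC_lim.
have -> : series (fun k => log_prod_coef (fun k => s k - t k) k * u ^+ k) =
  (fun n => series (fun k => log_prod_coef s k * u ^+ k) n - series (fun k => log_prod_coef t k * u
    ^+ k) n).
  apply/funext => n; rewrite /series /= -sumrB; apply: eq_bigr => k _.
  by rewrite /log_prod_coef; case: ltnP => _; rewrite ?mul0r ?subrr// ofRB; ring.
by apply: cvgB; [exact: psum_cvg (log_prod_coef_le sB) u1|exact: psum_cvg (log_prod_coef_le tB) u1].
Qed.

Lemma psum_log_prod_coef_le s B u : (forall k, (2 <= k)%N -> `|s k| <= B) -> modulus u < 1 ->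
  modulus (psum (log_prod_coef s) u) <= B / (1 - modulus u).
Proof.
move=> sB u1.
have rr : 0 <= modulus u < 1 by rewrite modulus_ge0.
have B0 : 0 <= B by apply: le_trans (sB 2%N isT).
have cg : cvgn (series (fun k => modulus u ^+ k)).
  by apply: nneg_bounded_series (geometric_series_le rr) => k; rewrite exprn_ge0// modulus_ge0.
have cBg : cvgn (series (B *: (fun k => modulus u ^+ k))) by apply: is_cvg_seriesZ.
apply: (le_trans (modulus_lim_series_le _ cBg)).
  by move=> n; rewrite modulusM modulusX; apply: ler_wpM2r (log_prod_coef_le sB n);
    rewrite exprn_ge0 ?modulus_ge0.
rewrite lim_seriesZ// ler_wpM2l//; apply: limr_le => //; apply: nearW => n;
  exact: geometric_series_le.
Qed.

Lemma psum_log_prod_coef_pow x u : 0 <= x <= 1 -> modulus u < 1 ->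
  psum (log_prod_coef (fun k => x ^+ k)) u = log1p (ofR x * u) - ofR x * u.
Proof.
move=> /andP[x0 x1] u1; apply: cvgC_lim.
have xu : modulus (ofR x * u) < 1.
  by rewrite modulusM modulus_ofR ger0_norm//; apply: le_lt_trans u1; rewrite ler_piMl ?modulus_ge0.
rewrite -(cvg_shiftn 2).
have -> : (fun n => series (fun k => log_prod_coef (fun k => x ^+ k) k * u ^+ k) (n + 2)%N) =
  (fun n => series (fun k => log1p_coef k * (ofR x * u) ^+ k) (n + 2)%N - ofR x * u).
  apply/funext => n; rewrite /series /= addn2 !big_nat_recl//= !mul0r !add0r !expr1.
  rewrite invr1 mulr1 opprK mul1r [X in _ = X - _]addrC addrK.
  by apply: eq_bigr => k _; rewrite /log_prod_coef /= ofRX exprMn; ring.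
apply: cvgB; last exact: cvg_cst.
rewrite (cvg_shiftn 2 (series (fun k => log1p_coef k * (ofR x * u) ^+ k))).
exact: psum_cvg log1p_coef_le _.
Qed.

Section Weights.
Variable x : nat -> R.
Hypothesis x01 : forall n, 0 <= x n <= 1.
Hypothesis cx2 : cvgn (series (fun n => x n ^+ 2)).

Definition powsum (k : nat) : R := limn (series (fun n => x n ^+ k)).

Lemma powsum_cvg k : (2 <= k)%N -> cvgn (series (fun n => x n ^+ k)).
Proof.
move=> k2; apply: series_le_cvg cx2 => n /=; have /andP[a b] := x01 n.
- exact: exprn_ge0.
- exact: exprn_ge0.
- exact: ler_wiXn2l.
Qed.

(** As x_n <= 1, the exponent 2 gives the slowest convergence; this makes the
    convergence of the power sums uniform in the exponent. *)
Lemma powsum_rem_le k N : (2 <= k)%N ->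
  0 <= powsum k - series (fun n => x n ^+ k) N <= powsum 2 - series (fun n => x n ^+ 2) N.
Proof.
move=> k2; apply/andP; split.
  rewrite subr_ge0; apply: nondecreasing_cvgn_le; last exact: powsum_cvg.
  apply/nondecreasing_seqP => n; rewrite /series /= big_nat_recr//= lerDl.
  by have /andP[a b] := x01 n; exact: exprn_ge0.
rewrite /powsum lerBlDr -lerBlDl.
have -> : limn (series (fun n => x n ^+ k)) - (limn (series (fun n => x n ^+ 2)) - series
  (fun n => x n ^+ 2) N) =
  limn (fun n => series (fun n => x n ^+ k) n - (series (fun n => x n ^+ 2) n - series (fun n => x n
    ^+ 2) N)).
  apply/esym/cvg_lim => //; apply: cvgB; first exact: powsum_cvg.
  by apply: cvgB => //; exact: cvg_cst.
apply: limr_le.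
  apply: is_cvgB; first exact: powsum_cvg.
  by apply: is_cvgB => //; exact: is_cvg_cst.
near=> n; have Nn : (N <= n)%N by near: n; exact: nbhs_infty_ge.
rewrite lerBlDr -lerBlDl !sub_series_geq//.
apply: ler_sum => i _; have /andP[a b] := x01 i; exact: ler_wiXn2l.
Unshelve. all: by end_near. Qed.

Lemma powsum_le k : (2 <= k)%N -> `|powsum k| <= powsum 2.
Proof.
move=> k2; have := powsum_rem_le 0 k2; rewrite /series /= !big_geq// !subr0 => /andP[a b].
by rewrite ger0_norm.
Qed.

(** The N-th partial product is the exponential of the power series built on the
    N-th partial power sums, and by [powsum_rem_le] those series converge to the
    one built on the full power sums. *)
Lemma cvg_prod_log u : modulus u < 1 ->
  (fun N => \prod_(0 <= n < N) ((1 + ofR (x n) * u) * cexp (- (ofR (x n) * u)))) @ \oo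
    --> cexp (psum (log_prod_coef powsum) u).
Proof.
move=> u1.
have serB N k : (2 <= k)%N -> `|series (fun n => x n ^+ k) N| <= N%:R.
  move=> k2; rewrite /series /=; apply: le_trans (ler_norm_sum _ _ _) _.
  apply: (@le_trans _ _ (\sum_(0 <= i < N) 1)); last by rewrite sumr_const_nat subn0.
  apply: ler_sum => i _; have /andP[a b] := x01 i.
  by rewrite ger0_norm ?exprn_ge0// exprn_ile1.
have PE N : \prod_(0 <= n < N) ((1 + ofR (x n) * u) * cexp (- (ofR (x n) * u))) =
   cexp (psum (log_prod_coef (fun k => series (fun n => x n ^+ k) N)) u).
  elim: N => [|N IH].
    rewrite big_geq//; have -> : psum (log_prod_coef (fun k => series (fun n => x n ^+ k) 0)) u = 0.
      apply: cvgC_lim; rewrite (_ : series _ = cst 0); first exact: cvg_cst.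
      apply/funext => n; rewrite /series /= big1// => k _; rewrite /log_prod_coef big_geq// ofR0
        mulr0.
      by case: ifP; rewrite mul0r.
    by rewrite cexp0.
  rewrite big_nat_recr//= IH; have /andP[xN0 xN1] := x01 N.
  have xu : modulus (ofR (x N) * u) < 1.
    by rewrite modulusM modulus_ofR ger0_norm//; apply: le_lt_trans u1;
      rewrite ler_piMl ?modulus_ge0.
  have -> : (1 + ofR (x N) * u) * cexp (- (ofR (x N) * u)) =
      cexp (psum (log_prod_coef (fun k => x N ^+ k)) u).
    by rewrite psum_log_prod_coef_pow ?x01// cexpD cexp_log1p.
  rewrite -cexpD.
  (* The factor of index N adds x_N^k to the k-th power sum. *)
  have -> : psum (log_prod_coef (fun k => series (fun n => x n ^+ k) N)) u =
    psum (log_prod_coef (fun k => series (fun n => x n ^+ k) N.+1)) u - psum (log_prod_coef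
      (fun k => x N ^+ k)) u.
    rewrite (@psum_log_prod_coefB _ _ N.+1%:R 1)//; last 2 first.
    - by move=> k k2; exact: serB.
    - by move=> k k2; rewrite ger0_norm ?exprn_ge0// exprn_ile1.
    congr (psum (log_prod_coef _) u); apply/funext => k.
    by rewrite /series /= big_nat_recr//= addrK.
  by rewrite subrK.
under eq_fun do rewrite PE.
apply: cvg_cexp.
apply: (cvgC_dominated (g := fun N => (powsum 2 - series (fun n => x n ^+ 2) N) / (1 - modulus u))).
  apply: nearW => N; rewrite modulusB (@psum_log_prod_coefB _ _ (powsum 2) N%:R)//; last 2 first.
  - exact: powsum_le.
  - by move=> k; exact: serB.
  apply: psum_log_prod_coef_le => // k k2.
  by have /andP[a b] := powsum_rem_le N k2; rewrite ger0_norm.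
rewrite -[X in _ --> X](mul0r (1 - modulus u)^-1); apply: cvgMl.
rewrite -[X in _ --> X](subrr (powsum 2)); apply: cvgB; first exact: cvg_cst.
exact: cx2.
Qed.

Lemma log_prod_derivable u : modulus u < 1 -> derivable (psum (log_prod_coef powsum)) u 1.
Proof.
move=> u1; have h := psum_is_derive (log_prod_coef_le powsum_le) u1; exact: ex_derive.
Qed.

End Weights.
End LogSeries.

(** * Holomorphy at a point and zeros of finite order *)

(** An inductive wrapper around complex differentiability at a point: comparing
    two functions then never unfolds the limit of the difference quotient. *)
Variant holo (R : realType) (f : Cplx R -> Cplx R) (z : Cplx R) : Prop :=
  Holo of derivable f z 1.

Section DerivableC.
Variable R : realType.
Local Notation C := (Cplx R).
Implicit Types (z w p : C) (f g : C -> C).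

Lemma holoP f z : holo f z <-> derivable f z 1.
Proof. by split=> [[]|]. Qed.

Lemma holo_is_derive f z d : is_derive z 1 f d -> holo f z.
Proof. by move=> h; apply: Holo; exact: ex_derive. Qed.

Lemma is_derive_holo f z : holo f z -> is_derive z 1 f ('D_1 f z).
Proof. by case=> h; exact: derivableP. Qed.

Lemma holoM f g z : holo f z -> holo g z -> holo (fun t => f t * g t) z.
Proof. by move=> /is_derive_holo hf /is_derive_holo hg; exact: holo_is_derive (is_deriveC_M hf hg).
Qed.

Lemma holoD f g z : holo f z -> holo g z -> holo (fun t => f t + g t) z.
Proof. by move=> /is_derive_holo hf /is_derive_holo hg; exact: holo_is_derive (is_deriveC_D hf hg).
Qed.

Lemma holo_comp f g z : holo f z -> holo g (f z) -> holo (fun t => g (f t)) z.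
Proof. by move=> /is_derive_holo hf /is_derive_holo hg; exact: holo_is_derive (is_deriveC_comp hf
  hg). Qed.

Lemma holo_cst (k z : C) : holo (fun=> k) z.
Proof. by apply: Holo; exact: derivable_cst. Qed.

Lemma holo_id z : holo (fun t : C => t) z.
Proof. by apply: Holo; exact: derivable_id. Qed.

Lemma holo_scale (k z : C) : holo (fun t => k * t) z.
Proof. exact: holo_is_derive (is_deriveC_scale k z). Qed.

Lemma holo_cexp f z : holo f z -> holo (fun t => cexp (f t)) z.
Proof.
by move=> hf; apply: (holo_comp hf); exact: holo_is_derive (is_derive_cexp (f z)).
Qed.

Lemma holo_prod (I : Type) (s : seq I) (F : I -> C -> C) z :
  (forall i, holo (F i) z) -> holo (fun t => \prod_(i <- s) F i t) z.
Proof.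
move=> hF; elim: s => [|i s IH].
  by under eq_fun do rewrite big_nil; exact: holo_cst.
rewrite (_ : (fun t => _) = (fun t => F i t * \prod_(i <- s) F i t)); last first.
  by apply/funext => t; rewrite big_cons.
exact: holoM.
Qed.

Lemma holo_exp f n z : holo f z -> holo (fun t => f t ^+ n) z.
Proof.
move=> hf; elim: n => [|n IH].
  by under eq_fun do rewrite expr0; exact: holo_cst.
rewrite (_ : (fun t => _) = (fun t => f t * f t ^+ n)); last first.
  by apply/funext => t; rewrite exprS.
exact: holoM.
Qed.

Lemma holo_inv f z : holo f z -> f z != 0 -> holo (fun t => (f t)^-1) z.
Proof. by move=> [hf] f0; apply: Holo; exact: derivableV. Qed.

Lemma holo_continuous f z : holo f z -> f t @[t --> z] --> f z.
Proof. by move=> /is_derive_holo h; exact: is_derive_continuousC h. Qed.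

Lemma near_holo f g z : (\forall t \near z, f t = g t) -> holo f z -> holo g z.
Proof. by move=> fg [hf]; apply: Holo; exact: (near_eq_derivable fg hf). Qed.

Lemma nearWC (P : C -> Prop) p : (forall z, P z) -> \forall z \near p, P z.
Proof. by move=> h; apply/near_discC; exists 1. Qed.

(** Order m of vanishing at p, in the form that a factorisation provides; m = 0
    means that f is holomorphic and nonzero near p. *)
Definition zero_order f p (m : nat) := exists h : C -> C,
  [/\ \forall z \near p, holo h z, h p != 0 &
      \forall z \near p, f z = (z - p) ^+ m * h z].

Lemma zero_orderM f g p m n : zero_order f p m -> zero_order g p n ->
  zero_order (fun z => f z * g z) p (m + n).
Proof.
move=> [h [dh h0 fh]] [k [dk k0 gk]]; exists (fun z => h z * k z); split.
- by apply: filterS2 dh dk => z; exact: holoM.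
- by rewrite mulf_neq0.
- by apply: filterS2 fh gk => z -> ->; rewrite exprD; ring.
Qed.

Lemma zero_order_neq0 f p : (\forall z \near p, holo f z) -> f p != 0 -> zero_order f p 0.
Proof.
by move=> df f0; exists f; split => //; apply: nearWC => z; rewrite expr0 mul1r.
Qed.

Lemma zero_order_prod (I : eqType) (s : seq I) (F : I -> C -> C) p :
  (forall i, i \in s -> exists m, zero_order (F i) p m) ->
  exists m, zero_order (fun z => \prod_(i <- s) F i z) p m.
Proof.
elim: s => [|i s IH] hF.
  exists 0%N; under eq_fun do rewrite big_nil; apply: zero_order_neq0; last exact: oner_neq0.
  by apply: nearWC => z; exact: holo_cst.
have [m hm] := hF i (mem_head _ _).
have [n hn] := IH (fun j js => hF j (@mem_behead _ (i :: s) j js)).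
by exists (m + n)%N; under eq_fun do rewrite big_cons; exact: zero_orderM.
Qed.

Lemma zero_order_scale f (k : C) p m : k != 0 -> zero_order f (k * p) m ->
  zero_order (fun z => f (k * z)) p m.
Proof.
move=> k0 [h [dh h0 fh]].
have ck : (k * z) @[z --> p] --> k * p by apply: (@holo_continuous (fun t => k * t));
  exact: holo_scale.
exists (fun z => k ^+ m * h (k * z)); split.
- have dh' : \forall z \near p, holo h (k * z) by exact: ck _ dh.
  apply: filterS dh' => z dz.
  apply: holoM; first exact: holo_cst.
  by apply: holo_comp dz; exact: holo_scale.
- by rewrite mulf_neq0// expf_neq0.
- have fh' : \forall z \near p, f (k * z) = (k * z - k * p) ^+ m * h (k * z) by exact: ck _ fh.
  by apply: filterS fh' => z ->; rewrite -mulrBr exprMn; ring.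
Qed.

Lemma zero_order_eq0 f p m : zero_order f p m -> (f p == 0) = (0 < m)%N.
Proof.
move=> [h [_ h0 /nbhs_singleton ->]]; rewrite subrr expr0n mulf_eq0 (negbTE h0) orbF.
by case: m => [|m]; rewrite ?eqxx// oner_eq0.
Qed.

End DerivableC.

(** * The Weierstrass product *)

Section Weierstrass.
Variable R : realType.
Local Notation C := (Cplx R).
Implicit Types (z w p u : C) (M n : nat).

(** After the substitution u = z / (M+1), the factors 1 + x_n u are the factors
    1 + z / (M+n+1) of the Weierstrass product, and |u| < 1 means |z| < M+1. *)
Definition tail_weight M n : R := M.+1%:R / (M + n).+1%:R.

Lemma tail_weight01 M n : 0 <= tail_weight M n <= 1.
Proof.
by rewrite divr_ge0//= ler_pdivrMr// mul1r ler_nat ltnS leq_addr.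
Qed.

(** The bound 2 - 2/(n+1) on the partial sums comes from 1/k^2 <= 2/k -
    2/(k+1). *)
Lemma cvg_series_sq : cvgn (series (fun n => n.+1%:R ^- 2 : R)).
Proof.
apply: (@nneg_bounded_series _ _ 2); first by move=> k; rewrite invr_ge0 exprn_ge0.
move=> n; suff : series (fun n => n.+1%:R ^- 2 : R) n <= 2 - 2 / n.+1%:R.
  by move=> /le_trans; apply; rewrite gerBl divr_ge0.
elim: n => [|n IH]; first by rewrite /series /= big_geq// divr1 subrr.
rewrite /series /= big_nat_recr//=; apply: le_trans (lerD IH (lexx _)) _.
have n1 : 1 <= n.+1%:R :> R by rewrite ler1n.
rewrite -[n.+2%:R]natr1; set a : R := n.+1%:R in n1 *.
have a0 : a != 0 by rewrite gt_eqF// (lt_le_trans _ n1).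
have a10 : a + 1 != 0 by rewrite gt_eqF// ltr_wpDl// (le_trans _ n1).
rewrite -subr_ge0.
have -> : 2 - 2 / (a + 1) - (2 - 2 / a + a ^- 2) = (a - 1) / (a ^+ 2 * (a + 1)).
  by field; apply/andP; split.
by rewrite divr_ge0 ?subr_ge0// mulr_ge0 ?sqr_ge0// addr_ge0// (le_trans _ n1).
Qed.

Lemma tail_weight_sq_cvg M : cvgn (series (fun n => tail_weight M n ^+ 2)).
Proof.
apply: (@series_le_cvg _ _ ((M.+1%:R ^+ 2) *: (fun n => n.+1%:R ^- 2 : R))).
- by move=> n; rewrite sqr_ge0.
- by move=> n; rewrite mulr_ge0 ?sqr_ge0// invr_ge0 sqr_ge0.
- move=> n; rewrite /tail_weight exprMn ler_wpM2l ?sqr_ge0// exprVn.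
  rewrite lef_pV2 ?posrE ?exprn_gt0// lerXn2r ?nnegrE// ler_nat ltnS leq_addl//.
- exact: is_cvg_seriesZ cvg_series_sq.
Qed.

Definition log_tail M z : C := psum (log_prod_coef (powsum (tail_weight M))) (z / M.+1%:R).

Lemma disc_scale M z : modulus z < M.+1%:R -> modulus (z / M.+1%:R) < 1.
Proof. by move=> h; rewrite modulusM modulusV modulus_nat ltr_pdivrMr// mul1r. Qed.

(** The upper bound of a partial product is exclusive: M+1 stands for M
    factors. *)
Lemma weierstrass_cvg M z : modulus z < M.+1%:R ->
  weierstrass_partial z @ \oo --> weierstrass_partial z M.+1 * cexp (log_tail M z).
Proof.
move=> zM.
have := cvg_prod_log (tail_weight01 M) (@tail_weight_sq_cvg M) (disc_scale zM) => h.
rewrite -(cvg_shiftn M.+1) /=.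
have -> : (fun n => weierstrass_partial z (n + M.+1)%N) = (fun N =>
  weierstrass_partial z M.+1 *
   \prod_(0 <= n < N) ((1 + ofR (tail_weight M n) * (z / M.+1%:R)) * cexp (- (ofR (tail_weight M
     n) * (z / M.+1%:R))))).
  apply/funext => N; rewrite /weierstrass_partial (@big_cat_nat _ _ _ M.+1)//=;
    last exact: leq_addl.
  congr (_ * _); rewrite -{1}[M.+1]add0n big_addn addnK; apply: eq_bigr => n _.
  have -> : ofR (tail_weight M n) * (z / M.+1%:R) = z / (n + M.+1)%:R.
    rewrite /tail_weight ofRM ofRV !ofR_nat addnS addnC.
    have a0 : M.+1%:R != 0 :> C by rewrite pnatr_eq0.
    have b0 : (n + M).+1%:R != 0 :> C by rewrite pnatr_eq0.
    by move: (M.+1%:R) ((n + M).+1%:R) a0 b0 => a b a0 b0; field; rewrite a0 b0.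
  by rewrite mulNr.
by apply: cvgMr; exact: h.
Qed.

Lemma modulus_archi z : exists M, modulus z < M.+1%:R.
Proof.
exists (Num.bound (modulus z)); apply: lt_trans (archi_boundP (modulus_ge0 z)) _.
by rewrite ltr_nat.
Qed.

Lemma weierstrass_is_cvg z : cvgn (weierstrass_partial z).
Proof. by have [M /weierstrass_cvg h] := modulus_archi z; apply/cvg_ex; eexists; exact: h. Qed.

Definition invGamma z : C := cexp (ofR (euler_gamma R) * z) * limn (weierstrass_partial z).

(** The local formula for the Weierstrass product, from which its analytic
    properties follow. *)
Lemma invGammaE M z : modulus z < M.+1%:R ->
  invGamma z = cexp (ofR (euler_gamma R) * z) * (weierstrass_partial z M.+1 * cexp (log_tail M z)).
Proof. by move=> /weierstrass_cvg h; rewrite /invGamma (cvgC_lim h). Qed.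

Lemma log_tail_holo M z : modulus z < M.+1%:R -> holo (log_tail M) z.
Proof.
move=> zM; apply: (@holo_comp _ (fun z => z / M.+1%:R)).
  by apply: holoM; [exact: holo_id|exact: holo_cst].
apply: Holo; exact: (log_prod_derivable (tail_weight01 M) (@tail_weight_sq_cvg M) (disc_scale zM)).
Qed.

Lemma near_modulus_lt (p : C) (r : R) : modulus p < r -> \forall z \near p, modulus z < r.
Proof.
move=> pr; apply/near_discC; exists (r - modulus p); first by rewrite subr_gt0.
move=> z h; rewrite -[z](subrK p); apply: le_lt_trans (modulusD _ _) _; lra.
Qed.

(** The weights with M = 0 are the 1/(n+1). *)
Lemma zetaE k : (2 <= k)%N -> zeta R k = powsum (tail_weight 0) k.
Proof.
move=> k2; apply: cvg_lim => //.
rewrite -cvg_shiftS.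
have -> : [sequence \sum_(1 <= k0 < n.+1) (k0%:R ^- k : R)]_n = series (fun n => tail_weight 0 n ^+
  k).
  apply/funext => n; rewrite /series /= big_add1 /=; apply: eq_bigr => i _.
  by rewrite /tail_weight add0n mul1r exprVn.
exact: (powsum_cvg (tail_weight01 0) (@tail_weight_sq_cvg 0) k2).
Qed.

Lemma ell1_partialE z : ell_partial 1 z =
  (fun N => ofR (euler_gamma R) * z + series (fun k => log_prod_coef (powsum (tail_weight 0))
    k * (z / 1%:R) ^+ k) N).
Proof.
apply/funext => N; rewrite /ell_partial eqxx; congr (_ + _).
rewrite divr1 /series /= -sumrN.
have [N2|N2] := leqP N 2.
  rewrite [LHS]big_geq// [RHS]big1_seq// => k /andP[_]; rewrite mem_index_iota => /andP[_ kN].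
  by rewrite /log_prod_coef (leq_trans kN N2) mul0r.
rewrite [RHS](@big_cat_nat _ _ _ 2)//=; last exact: ltnW.
rewrite [X in _ = X + _]big1_seq ?add0r; last first.
  by move=> k /andP[_]; rewrite mem_index_iota => /andP[_ k2]; rewrite /log_prod_coef k2 mul0r.
rewrite big_nat [RHS]big_nat; apply: eq_bigr => k /andP[k2 _].
rewrite /log_prod_coef ltnNge k2 /= zetaE// /log1p_coef.
case: k k2 => // k k2; rewrite -[- z]mulN1r exprMn; ring.
Qed.

Lemma ell1_cvg z : modulus z < 1 ->
  ell_partial 1 z @ \oo --> ofR (euler_gamma R) * z + log_tail 0 z.
Proof.
move=> z1; rewrite ell1_partialE; apply: cvgD; first exact: cvg_cst.
apply: (psum_cvg (log_prod_coef_le (powsum_le (tail_weight01 0) (@tail_weight_sq_cvg 0)))).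
by rewrite divr1.
Qed.

Lemma ell1E z : modulus z < 1 -> ell 1 z = ofR (euler_gamma R) * z + log_tail 0 z.
Proof. by move=> /ell1_cvg h; exact: cvgC_lim h. Qed.

Lemma cexp_ell1 z : modulus z < 1 -> cexp (ell 1 z) = invGamma z.
Proof.
move=> z1; rewrite ell1E// cexpD (@invGammaE 0)// /weierstrass_partial big_geq// mul1r//.
Qed.

Lemma ell1_holo z : modulus z < 1 -> holo (@ell R 1) z.
Proof.
move=> z1; apply: (@near_holo _ (fun z => ofR (euler_gamma R) * z + log_tail 0 z)).
  by have := near_modulus_lt z1; apply: filterS => t /ell1E.
by apply: holoD; [exact: holo_scale|exact: log_tail_holo].
Qed.

Lemma weierstrass_partial_holo M z : holo (fun t : C => weierstrass_partial t M) z.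
Proof.
apply: holo_prod => n; apply: holoM.
  apply: holoD; first exact: holo_cst.
  by apply: holoM; [exact: holo_id|exact: holo_cst].
apply: holo_cexp; under eq_fun do rewrite mulNr -mulrN mulrC; exact: holo_scale.
Qed.

Lemma invGamma_entire : entire invGamma.
Proof.
move=> z _; apply/holoP; have [M zM] := modulus_archi z.
apply: (@near_holo _ (fun z => cexp (ofR (euler_gamma R) * z) * (weierstrass_partial z M.+1 * cexp
  (log_tail M z)))).
  by have := near_modulus_lt zM; apply: filterS => t /invGammaE ->.
apply: holoM; first by apply: holo_cexp; exact: holo_scale.
apply: holoM; first exact: weierstrass_partial_holo.
by apply: holo_cexp; exact: log_tail_holo.
Qed.

Lemma linear_factor_order n p : (0 < n)%N -> exists m, zero_order (fun z : C => 1 + z / n%:R) p m.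
Proof.
move=> n0; have nn : n%:R != 0 :> C by rewrite pnatr_eq0 -lt0n.
have d z : holo (fun z : C => 1 + z / n%:R) z.
  apply: holoD; first exact: holo_cst.
  by apply: holoM; [exact: holo_id|exact: holo_cst].
have [p0|p0] := eqVneq (1 + p / n%:R) 0; last first.
  by exists 0%N; apply: zero_order_neq0 => //; exact: nearWC.
exists 1%N, (fun=> n%:R^-1); split.
- by apply: nearWC => z; exact: holo_cst.
- by rewrite invr_neq0.
- apply: nearWC => z; rewrite expr1 mulrBl -[RHS]addr0 -p0; ring.
Qed.

(** Each of the finitely many factors in front of the exponential in [invGammaE]
    has a zero of order at most 1. *)
Lemma invGamma_order p : exists m, zero_order invGamma p m.
Proof.
have [M pM] := modulus_archi p.
have [m [h [dh h0 fh]]] : exists m, zero_order (fun z => weierstrass_partial z M.+1) p m.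
  apply: zero_order_prod => n; rewrite mem_index_iota => /andP[n0 _].
  have [m hm] := linear_factor_order p n0; exists (m + 0)%N.
  apply: zero_orderM => //; apply: zero_order_neq0; last exact: cexp_neq0.
  apply: nearWC => z; apply: holo_cexp.
  by under eq_fun do rewrite mulNr -mulrN mulrC; exact: holo_scale.
exists m, (fun z => cexp (ofR (euler_gamma R) * z) * (h z * cexp (log_tail M z))); split.
- apply: filterS2 dh (near_modulus_lt pM) => z hz zM.
  apply: holoM; first by apply: holo_cexp; exact: holo_scale.
  by apply: holoM => //; apply: holo_cexp; exact: log_tail_holo.
- by rewrite mulf_neq0 ?cexp_neq0// mulf_neq0 ?cexp_neq0.
- by apply: filterS2 fh (near_modulus_lt pM) => z hz zM; rewrite (invGammaE zM) hz; ring.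
Qed.

Lemma negative_integersP z : negative_integers z <-> exists2 n, (0 < n)%N & z = - n%:R.
Proof.
split=> [[m /= m1 <-]|[n n0 ->]].
  by case: m m1 => // n _; exists n.+1.
exists (- n%:Z); first by rewrite /= lerN2 lez_nat.
by rewrite mulrNz.
Qed.

Lemma invGamma_eq0 z : invGamma z = 0 <-> negative_integers z.
Proof.
have [M zM] := modulus_archi z; rewrite (invGammaE zM).
have -> : cexp (ofR (euler_gamma R) * z) * (weierstrass_partial z M.+1 * cexp (log_tail M z)) =
  0 <->
    weierstrass_partial z M.+1 = 0.
  split=> [/eqP|->]; last by rewrite mul0r mulr0.
  by rewrite mulf_eq0 (negbTE (cexp_neq0 (_ * z))) /= mulf_eq0 (negbTE (cexp_neq0 (log_tail M z)))
    orbF => /eqP.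
rewrite /weierstrass_partial; split=> [/eqP|/negative_integersP[n n0 zn]].
  rewrite prodf_seq_eq0 => /hasP[n]; rewrite mem_index_iota => /andP[n0 nM].
  rewrite mulf_eq0 (negbTE (cexp_neq0 _)) orbF => /eqP h.
  have nn : n%:R != 0 :> C by rewrite pnatr_eq0 -lt0n.
  apply/negative_integersP; exists n => //.
  move/eqP: h; rewrite addrC addr_eq0 => /eqP e.
  by rewrite -[z](divfK nn) e mulN1r.
have nn : n%:R != 0 :> C by rewrite pnatr_eq0 -lt0n.
apply/eqP; rewrite prodf_seq_eq0; apply/hasP; exists n.
  by rewrite mem_index_iota n0/=; move: zM; rewrite zn modulusN modulus_nat ltr_nat.
by rewrite /= zn mulNr divff// subrr mul0r.
Qed.

End Weierstrass.

(** * Integration up to a singular endpoint *)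

Section ImproperFTC.
Variable R : realType.
Notation mu := (@lebesgue_measure R).
Implicit Types (f F : R -> R) (t : R).

Lemma eventually_ge_inv t : 0 < t -> \forall k \near \oo, (k.+2%:R : R)^-1 <= t.
Proof.
move=> t0; near=> k; rewrite invf_ple ?posrE//.
have : t^-1 <= k%:R by near: k; exact: nbhs_infty_ger.
by move=> /le_trans; apply; rewrite ler_nat -addn2 leq_addr.
Unshelve. all: by end_near. Qed.

Variables (f F : R -> R) (N L : R).
Hypothesis N1 : 1 <= N.
Hypothesis dF : forall t, 0 < t -> is_derive t 1 F (f t).
Hypothesis cf : forall t, 0 < t -> {for t, continuous f}.
Hypothesis FL : F (k.+2%:R^-1) @[k --> \oo] --> L.

Let D : set R := `]0, N].
Let Ik k : set R := `[k.+2%:R^-1, N].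

Lemma inv_lt1 k : (k.+2%:R : R)^-1 < N.
Proof. by apply: lt_le_trans N1; rewrite invf_lt1// ltr1n. Qed.

Lemma integral_Ik k : (\int[mu]_(t in Ik k) (f t)%:E = (F N)%:E - (F k.+2%:R^-1)%:E)%E.
Proof.
have cF t : 0 < t -> {for t, continuous F}.
  by move=> /dF h; apply/differentiable_continuous/derivable1_diffP; exact: ex_derive.
have e0 : 0 < (k.+2%:R : R)^-1 by rewrite invr_gt0.
apply: continuous_FTC2; first exact: inv_lt1.
- apply: continuous_in_subspaceT => t; rewrite inE /= in_itv /= => /andP[t0 _].
  by apply: cf; exact: lt_le_trans t0.
- split.
  + move=> t; rewrite in_itv /= => /andP[t0 _].
    by have h := dF (lt_trans e0 t0); exact: ex_derive.
  + by apply: cvg_at_right_filter; exact: cF.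
  + by apply: cvg_at_left_filter; apply: cF; exact: lt_trans (inv_lt1 k).
- move=> t; rewrite in_itv /= => /andP[t0 _]; rewrite derive1E.
  by have h := dF (lt_trans e0 t0); exact: derive_val.
Qed.

Lemma measurable_on_pos (A : set R) : measurable A -> A `<=` [set t | 0 < t] -> measurable_fun A f.
Proof.
move=> mA Apos; apply: (@measurable_funS _ _ _ _ (`]0, +oo[%classic : set R)) => //.
  by move=> t /Apos /= t0; rewrite in_itv /= andbT.
apply: open_continuous_measurable_fun => //.
by move=> t; rewrite inE /= in_itv /= andbT; exact: cf.
Qed.

Lemma D_pos : D `<=` [set t | 0 < t].
Proof. by move=> t; rewrite /D /= in_itv /= => /andP[]. Qed.

Lemma Ik_sub k : Ik k `<=` D.
Proof.
move=> t; rewrite /D /Ik /= !in_itv /= => /andP[h ->]; rewrite andbT.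
by apply: lt_le_trans h; rewrite invr_gt0.
Qed.

Lemma patch_Ik_cvg t : D t -> ((EFin \o f) \_ (Ik k)) t @[k --> \oo] --> (f t)%:E.
Proof.
move=> Dt; have t0 := D_pos Dt; apply: cvg_near_cst; near=> k.
rewrite patchE mem_set// /Ik /= in_itv /=; apply/andP; split.
  by near: k; exact: eventually_ge_inv.
by move: Dt; rewrite /D /= in_itv /= => /andP[].
Unshelve. all: by end_near. Qed.

Lemma measurable_patch k : measurable_fun D ((EFin \o f) \_ (Ik k)).
Proof.
apply: (iffLR (measurable_restrict _ (measurable_itv _) (measurable_itv _))).
apply/measurable_EFinP; apply: measurable_on_pos; first exact: measurableI.
by apply: subset_trans D_pos; exact: subIsetl.
Qed.

Lemma integral_patch k : (\int[mu]_(t in D) ((EFin \o f) \_ (Ik k)) t = (F N)%:E - (F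
  k.+2%:R^-1)%:E)%E.
Proof.
by rewrite -integral_mkcondr (setIidr (@Ik_sub k)) integral_Ik.
Qed.

Lemma lim_primitive : ((F N)%:E - (F k.+2%:R^-1)%:E)%E @[k --> \oo] --> (F N - L)%:E.
Proof.
by apply: cvg_EFin; [exact: nearW|apply: cvgB => //; exact: cvg_cst].
Qed.

(** The primitive need only have a limit at 0, where f may be unbounded: the
    intervals [1/(k+2), N] exhaust ]0, N], and monotone convergence applies. *)
Lemma ge0_integral_FTC_singular : (forall t, 0 < t -> 0 <= f t) ->
  (\int[mu]_(t in D) (f t)%:E = (F N - L)%:E)%E.
Proof.
move=> f0.
have := @cvg_monotone_convergence _ _ _ mu D _ (fun k => (EFin \o f) \_ (Ik k)).
move=> /(_ (measurable_itv _) measurable_patch) h.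
have : (\int[mu]_(t in D) ((EFin \o f) \_ (Ik k)) t @[k --> \oo] --> \int[mu]_(t in D) (f t)%:E)%E.
  have -> : (\int[mu]_(t in D) (f t)%:E = \int[mu]_(t in D) (limn (fun k => ((EFin \o f) \_ (Ik k))
    t)))%E.
    by apply: eq_integral => t; rewrite inE => Dt; apply/esym/cvg_lim => //; exact: patch_Ik_cvg.
  apply: h.
    by move=> k t Dt; rewrite patchE; case: ifP => // _; rewrite lee_fin f0//; exact: D_pos.
  move=> t Dt m n mn; rewrite !patchE.
  case: ifPn => [|_]; last by case: ifP => // _; rewrite lee_fin f0//; exact: D_pos.
  rewrite inE /Ik /= in_itv /= => /andP[a b]; rewrite mem_set// /= in_itv /= b andbT.
  by apply: le_trans a; rewrite lef_pV2 ?posrE// ler_nat.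
under eq_fun do rewrite integral_patch.
by move/cvg_lim => <- //; apply: cvg_lim => //; exact: lim_primitive.
Qed.

Lemma ge0_integrable_FTC_singular : (forall t, 0 < t -> 0 <= f t) -> mu.-integrable D (EFin \o f).
Proof.
move=> f0; apply/integrableP; split; first by apply/measurable_EFinP;
  exact: (measurable_on_pos (measurable_itv _) D_pos).
have -> : (\int[mu]_(t in D) `|(EFin \o f) t| = \int[mu]_(t in D) (f t)%:E)%E.
  by apply: eq_integral => t; rewrite inE => /D_pos t0; rewrite /= ger0_norm// f0.
by rewrite ge0_integral_FTC_singular// ltry.
Qed.

(** The same exhaustion for functions without a sign, by dominated
    convergence. *)
Lemma dominated_integral_FTC_singular (g : R -> R) : mu.-integrable D (EFin \o g) ->
  (forall t, 0 < t -> `|f t| <= g t) ->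
  mu.-integrable D (EFin \o f) /\ (\int[mu]_(t in D) (f t)%:E = (F N - L)%:E)%E.
Proof.
move=> ig fg.
have mf : measurable_fun D (EFin \o f) by apply/measurable_EFinP;
  exact: (measurable_on_pos (measurable_itv _) D_pos).
have [|||fi _ lim] := @dominated_convergence _ _ _ mu D (measurable_itv _)
  (fun k => (EFin \o f) \_ (Ik k)) (EFin \o f) (EFin \o g) measurable_patch mf.
- by apply: aeW => t; exact: patch_Ik_cvg.
- exact: ig.
- apply: aeW => t k Dt; rewrite patchE; case: ifP => _ /=.
    by rewrite lee_fin fg//; exact: D_pos.
  by rewrite normr0 lee_fin; apply: le_trans (fg _ (D_pos Dt)).
- split => //; move: lim; under eq_fun do rewrite integral_patch.
  by move/cvg_lim => <- //; apply: cvg_lim => //; exact: lim_primitive.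
Qed.

End ImproperFTC.

(** * Gauss's integrals *)

Section ComplexPower.
Variable R : realType.
Local Notation C := (Cplx R).
Notation mu := (@lebesgue_measure R).
Implicit Types (s z w : C) (t x : R).

Definition cpow s t : C := cexp (s * ofR (ln t)).

Lemma cexp_ofR x : cexp (ofR x) = ofR (expR x).
Proof. by rewrite /cexp /= cos0 sin0 mulr1. Qed.

Lemma cpowD1 s t : 0 < t -> cpow (s + 1) t = cpow s t * ofR t.
Proof. by move=> t0; rewrite /cpow mulrDl mul1r cexpD cexp_ofR lnK. Qed.

Lemma modulus_cpow s t : modulus (cpow s t) = expR (complex.Re s * ln t).
Proof. by rewrite modulus_cexp mulrC ReMr mulrC. Qed.

Lemma inv_cvg0 : (k.+2%:R : R)^-1 @[k --> \oo] --> (0 : R).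
Proof.
have := @cvg_harmonic R; rewrite -cvg_shiftS; apply: cvg_trans.
by apply: near_eq_cvg; apply: nearW.
Qed.

Lemma expR_ln_cvg0 x : 0 < x -> expR (x * ln (k.+2%:R^-1)) @[k --> \oo] --> (0 : R).
Proof.
move=> x0; have /cvg_at_rightP h := @powR_cvg0 R x x0.
have := h (fun k => k.+2%:R^-1); move=> /(_ _)/wrap[].
  by split; [move=> n; rewrite invr_gt0|exact: inv_cvg0].
by apply: cvg_trans; apply: near_eq_cvg; apply: nearW => k; rewrite /powR invr_eq0 pnatr_eq0.
Qed.

Section Projection.
Variable pr : C -> R.
Hypothesis prD : forall z w, pr (z + w) = pr z + pr w.
Hypothesis prle : forall z, `|pr z| <= modulus z.
Hypothesis prZ : forall x z, pr (ofR x * z) = x * pr z.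

Lemma prN z : pr (- z) = - pr z.
Proof. by rewrite -[- z]mulN1r -ofR1 -ofRN prZ mulN1r. Qed.

Lemma pr_cpow_is_derive (c s : C) t : 0 < t ->
  is_derive t 1 (fun t => pr (c * cpow s t)) (t^-1 * pr (s * (c * cpow s t))).
Proof.
move=> t0; rewrite mulrC.
have h := @is_derive_line R pr (fun y => c * cexp y) s (ln t) _ prD prle prZ
  (is_deriveC_comp (is_derive_cexp _) (is_deriveC_scale c _)).
rewrite (_ : (fun t => _) = (fun x => pr (c * cexp (ofR x * s))) \o @ln R); last first.
  by apply/funext => x; rewrite /= /cpow mulrC [_ * s]mulrC mulrC.
rewrite /cpow [s * ofR _]mulrC.
exact: is_derive1_comp h (is_derive1_ln t0).
Qed.

Lemma pr_cpow_continuous (c s : C) t : 0 < t ->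
  {for t, continuous (fun t => pr (c * cpow s t))}.
Proof.
move=> /(pr_cpow_is_derive c s) h.
by apply/differentiable_continuous/derivable1_diffP; exact: ex_derive.
Qed.

Section Interval.
Variable N : nat.
Hypothesis N0 : (0 < N)%N.
Let D : set R := `]0, N%:R].

Lemma N1R : 1 <= N%:R :> R. Proof. by rewrite ler1n. Qed.

Lemma modulus_cpow_integrable s : 0 < complex.Re s + 1 ->
  mu.-integrable D (EFin \o (fun t => modulus (cpow s t))).
Proof.
set a := complex.Re s => a0.
have -> : (fun t => modulus (cpow s t)) = (fun t => expR (a * ln t)).
  by apply/funext => t; rewrite modulus_cpow.
pose f t := expR (a * ln t).
pose F t := (a + 1)^-1 * expR ((a + 1) * ln t).
have H1 t : 0 < t -> is_derive t 1 F (f t).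
  move=> t0.
  have dl : is_derive t 1 (@ln R) t^-1 by exact: is_derive1_ln.
  have d1 : is_derive t 1 (fun t => (a + 1) * ln t) ((a + 1) * t^-1) by exact: is_deriveZ.
  have d2 := @is_derive1_comp R expR (fun t => (a + 1) * ln t) t _ _ (is_derive_expR _) d1.
  have d3 : is_derive t 1 (fun t => (a + 1)^-1 * expR ((a + 1) * ln t)) _ := is_deriveZ (a + 1)^-1
    d2.
  apply: (is_derive_eq d3); rewrite /GRing.scale /=.
  rewrite mulrDl mul1r expRD lnK//.
  by rewrite /f; field; rewrite !gt_eqF.
have H2 t : 0 < t -> {for t, continuous f}.
  move=> t0; have dl : is_derive t 1 (@ln R) t^-1 by exact: is_derive1_ln.
  have d1 : is_derive t 1 (fun t => a * ln t) (a * t^-1) by exact: is_deriveZ.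
  have d2 := @is_derive1_comp R expR (fun t => a * ln t) t _ _ (is_derive_expR _) d1.
  apply/differentiable_continuous/derivable1_diffP.
  exact: (@ex_derive _ _ _ _ _ _ _ d2).
have H3 : F (k.+2%:R^-1) @[k --> \oo] --> 0.
  by rewrite -[X in _ --> X](mulr0 (a + 1)^-1); apply: cvgMr; exact: expR_ln_cvg0.
have H4 t : 0 < t -> 0 <= f t by move=> _; exact: expR_ge0.
exact: (ge0_integrable_FTC_singular N1R H1 H2 H3 H4).
Qed.

(** Since Re s > -1, the modulus of t^s is integrable at 0, and the primitive
    t^(s+1)/(s+1) tends to 0 there. *)
Lemma cpow_integral s : 0 < complex.Re s + 1 ->
  mu.-integrable D (EFin \o (fun t => pr (cpow s t))) /\
  \int[mu]_(t in D) pr (cpow s t) = pr (cpow (s + 1) N%:R / (s + 1)).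
Proof.
move=> a0.
have s1 : s + 1 != 0.
  by apply/eqP => h; move: a0; rewrite -[complex.Re s + 1]/(complex.Re s + complex.Re (1 : C)) -ReD
    h ltxx.
pose f t := pr (cpow s t).
pose F t := pr ((s + 1)^-1 * cpow (s + 1) t).
have H1 t : 0 < t -> is_derive t 1 F (f t).
  move=> t0; apply: (is_derive_eq (pr_cpow_is_derive (s + 1)^-1 (s + 1) t0)).
  rewrite mulrA divff// mul1r cpowD1// -(prZ t^-1).
  by rewrite mulrCA -ofRM mulVf ?gt_eqF// ofR1 mulr1.
have H2 t : 0 < t -> {for t, continuous f}.
  move=> t0; have := @pr_cpow_continuous 1 s t t0.
  by rewrite (_ : (fun t => pr (1 * cpow s t)) = f)//; apply/funext => x; rewrite mul1r.
have H3 : F (k.+2%:R^-1) @[k --> \oo] --> 0.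
  have h := expR_ln_cvg0 a0.
  apply/cvgr0Pnorm_lt.
  have : (modulus (s + 1)^-1 * expR ((complex.Re s + 1) * ln (k.+2%:R^-1))) @[k --> \oo] -->
    (0 : R).
    by rewrite -[X in _ --> X](mulr0 (modulus (s + 1)^-1)); apply: cvgMr.
  move=> /cvgr0Pnorm_lt h2 e /h2; apply: filterS => k; apply: le_lt_trans.
  apply: le_trans (prle _) _; rewrite modulusM modulus_cpow ReD.
  exact: ler_norm.
have H4 t : 0 < t -> `|f t| <= modulus (cpow s t) by move=> _; exact: prle.
have [i1 i2] := dominated_integral_FTC_singular N1R H1 H2 H3 (modulus_cpow_integrable a0) H4.
split => //; rewrite /Rintegral i2 /= subr0 mulrC//.
Qed.

Definition gauss_prod (n : nat) s : C := \prod_(0 <= k < n.+1) (s + 1 + k%:R).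

Lemma re_shift_neq0 s k : 0 < complex.Re s + 1 -> s + 1 + k%:R != 0.
Proof.
move=> a0; apply/eqP => h.
have : 0 < complex.Re (s + 1 + k%:R).
  by rewrite -ofR_nat !ReD; apply: ltr_wpDr.
by rewrite h ltxx.
Qed.

Lemma gauss_prod_neq0 n s : 0 < complex.Re s + 1 -> gauss_prod n s != 0.
Proof.
move=> a0; rewrite /gauss_prod prodf_seq_neq0; apply/allP => k _.
by rewrite /= re_shift_neq0.
Qed.

(** Induction on n: multiplying the integrand by 1 - t/N subtracts from the
    integral at s the integral at s+1 divided by N, and the closed forms satisfy
    the same recursion. *)
Lemma gauss_integral n s : 0 < complex.Re s + 1 ->
  mu.-integrable D (EFin \o (fun t => (1 - t / N%:R) ^+ n * pr (cpow s t))) /\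
  \int[mu]_(t in D) ((1 - t / N%:R) ^+ n * pr (cpow s t)) =
    pr (n`!%:R * cpow (s + 1) N%:R / gauss_prod n s).
Proof.
have N0R : 0 < N%:R :> R by rewrite ltr0n.
elim: n s => [|n IH] s a0.
  have [h1 h2] := cpow_integral a0.
  rewrite /gauss_prod big_nat1 addr0 fact0 mul1r -h2.
  by under eq_fun do rewrite expr0 mul1r.
have a0' : 0 < complex.Re (s + 1) + 1.
  by rewrite ReD /= addrAC; apply: addr_gt0.
have [h1 h2] := IH s a0; have [k1 k2] := IH (s + 1) a0'.
have E t : D t -> (1 - t / N%:R) ^+ n.+1 * pr (cpow s t) =
    (1 - t / N%:R) ^+ n * pr (cpow s t) - N%:R^-1 * ((1 - t / N%:R) ^+ n * pr (cpow (s + 1) t)).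
  rewrite /D /= in_itv /= => /andP[t0 _].
  rewrite cpowD1// [cpow s t * _]mulrC (prZ t) exprS; ring.
have k1' : mu.-integrable D (EFin \o (fun t => N%:R^-1 * ((1 - t / N%:R) ^+ n * pr (cpow (s + 1)
  t)))).
  exact: (@integrableZl _ _ _ mu D (measurable_itv _) N%:R^-1 _ k1).
split.
  have := (@integrableB _ _ _ mu D (measurable_itv _) _ _ h1 k1'); apply: eq_integrable;
    first exact: measurable_itv.
  by move=> t; rewrite inE => /E /= ->.
have -> : \int[mu]_(t in D) ((1 - t / N%:R) ^+ n.+1 * pr (cpow s t)) =
    \int[mu]_(t in D) ((1 - t / N%:R) ^+ n * pr (cpow s t) - N%:R^-1 * ((1 - t / N%:R) ^+ n * pr
      (cpow (s + 1) t))).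
  by apply: eq_Rintegral => t; rewrite inE => /E.
rewrite (@RintegralB _ _ _ mu D _ _ (measurable_itv _) h1 k1').
rewrite (@RintegralZl _ _ _ mu D _ _ (measurable_itv _) k1) h2 k2 -prZ -prN -prD; congr pr.
have P1 : gauss_prod n.+1 s = gauss_prod n s * (s + n.+2%:R).
  by rewrite /gauss_prod [LHS]big_nat_recr//= -[n.+2%:R]natr1 -[n.+1%:R]natr1; ring.
have P2 : gauss_prod n.+1 s = (s + 1) * gauss_prod n (s + 1).
  rewrite /gauss_prod [LHS]big_nat_recl//= addr0; congr (_ * _).
  by apply: eq_bigr => k _; rewrite -natr1; ring.
have g1 := gauss_prod_neq0 n a0; have g2 := gauss_prod_neq0 n a0'.
have g3 := gauss_prod_neq0 n.+1 a0.
have q1 : (gauss_prod n s)^-1 = (s + n.+2%:R) / gauss_prod n.+1 s.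
  by move: g3; rewrite P1 mulf_eq0 negb_or => /andP[_ g3]; rewrite invfM mulrCA divff ?mulr1.
have q2 : (gauss_prod n (s + 1))^-1 = (s + 1) / gauss_prod n.+1 s.
  by move: g3; rewrite P2 mulf_eq0 negb_or => /andP[g3 _]; rewrite invfM mulrA divff ?mul1r.
rewrite q1 q2 [cpow (s + 1 + 1) _]cpowD1// ofRV !ofR_nat factS
  natrM -[n.+2%:R]natr1 -[n.+1%:R]natr1.
have NC : N%:R != 0 :> C by rewrite pnatr_eq0 -lt0n.
by field; rewrite NC g3.
Qed.

End Interval.
End Projection.
End ComplexPower.

(** * Gauss's limit *)

Section GaussLimit.
Variable R : realType.
Local Notation C := (Cplx R).
Notation mu := (@lebesgue_measure R).
Implicit Types (s z w : C) (t x : R).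

Lemma gauss_exp_le N t : 0 <= t <= N.+1%:R -> (1 - t / N.+1%:R) ^+ N.+1 <= expR (- t).
Proof.
move=> /andP[t0 tN].
have N0 : N.+1%:R != 0 :> R by [].
have -> : expR (- t) = expR (- (t / N.+1%:R)) ^+ N.+1.
  by rewrite -expRM_natr mulNr divfK.
apply: lerXn2r; rewrite ?nnegrE ?expR_ge0//.
  by rewrite subr_ge0 ler_pdivrMr// mul1r.
exact: expR_ge1Dx.
Qed.

(** The inverse of 1 - t/N is 1 + t/(N-t), at most e^(t/(N-t)). *)
Lemma gauss_exp_ge N t : 0 <= t < N.+1%:R ->
  expR (- (t * (N.+1%:R / (N.+1%:R - t)))) <= (1 - t / N.+1%:R) ^+ N.+1.
Proof.
move=> /andP[t0 tN].
have N0 : N.+1%:R != 0 :> R by [].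
have Nt : 0 < N.+1%:R - t by rewrite subr_gt0.
have -> : expR (- (t * (N.+1%:R / (N.+1%:R - t)))) = (expR (t / (N.+1%:R - t)))^-1 ^+ N.+1.
  by rewrite -expRN -expRM_natr; congr expR; rewrite mulNr -mulrA [_^-1 * _]mulrC.
have q0 : 0 < 1 - t / N.+1%:R by rewrite subr_gt0 ltr_pdivrMr// mul1r.
apply: lerXn2r; rewrite ?nnegrE ?invr_ge0 ?expR_ge0 ?(ltW q0)//.
rewrite invf_ple ?posrE ?expR_gt0//.
have -> : (1 - t / N.+1%:R)^-1 = 1 + t / (N.+1%:R - t).
  move: q0 => /lt0r_neq0; have := lt0r_neq0 Nt; move: (N.+1%:R) N0 => n n0 h1 h2.
  have e : 1 - t / n = (n - t) / n by field.
  by rewrite e invfM invrK; field.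
exact: expR_ge1Dx.
Qed.

Lemma cvg_ratio x : (N.+1%:R / (N.+1%:R - x)) @[N --> \oo] --> (1 : R).
Proof.
have h : (1 - x * harmonic N) @[N --> \oo] --> (1 : R).
  rewrite -[X in _ --> X]subr0 -[X in _ --> _ - X](mulr0 x).
  by apply: cvgB; [exact: cvg_cst|apply: cvgMr; exact: cvg_harmonic].
have -> : (fun N => N.+1%:R / (N.+1%:R - x)) = (fun N => (1 - x * harmonic N)^-1).
  apply/funext => N /=; have N0 : N.+1%:R != 0 :> R by [].
  have -> : N.+1%:R - x = N.+1%:R * (1 - x / N.+1%:R) by rewrite mulrBr mulr1 mulrCA divff// mulr1.
  by rewrite invfM mulrA divff// mul1r.
by rewrite -[X in _ --> X]invr1; apply: cvgV => //; exact: oner_neq0.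
Qed.

Lemma gauss_exp_cvg t : 0 <= t -> (1 - t / N.+1%:R) ^+ N.+1 @[N --> \oo] --> expR (- t).
Proof.
move=> t0.
apply: (@squeeze_cvgr _ _ _ _ (fun N => expR (- (t * (N.+1%:R / (N.+1%:R - t))))) (fun=> expR
  (- t))).
- near=> N.
  have tN : t < N.+1%:R.
    apply: (@lt_trans _ _ (N%:R)); last by rewrite ltr_nat.
    by near: N; exact: nbhs_infty_gtr.
  by rewrite gauss_exp_ge ?t0// gauss_exp_le// t0 ltW.
- apply: continuous_cvg; first exact: continuous_expR.
  rewrite -[X in _ --> - X]mulr1; apply: cvgN; apply: cvgMr; exact: cvg_ratio.
- exact: cvg_cst.
Unshelve. all: by end_near. Qed.

Let P : set R := `]0, +oo[.

(** Near 0 the function is dominated by t^(Re z), with Re z > -1. For t >= 1 it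
    is dominated by t e^(-t) <= 2 e^(-t/2), since Re z < 1. *)
Lemma pos_dominant_integrable z : modulus z < 1 ->
  mu.-integrable P (EFin \o (fun t => modulus (cpow z t) * expR (- t))).
Proof.
move=> z1.
have /andP[a1 a2] : -1 < complex.Re z < 1.
  by rewrite -ltr_norml; apply: le_lt_trans z1; exact: modulus_Re.
set a := complex.Re z in a1 a2.
have a10 : 0 < a + 1 by lra.
have i1 : mu.-integrable P ((EFin \o (fun t => modulus (cpow z t))) \_ `]0, 1%:R]).
  apply: (iffLR (@integrable_restrict _ _ _ mu (`]0, 1%:R] : set R) (measurable_itv _) P
    (measurable_itv _) _)).
  have -> : P `&` `]0, 1%:R] = `]0, 1%:R]%classic.
    by apply: setIidr => t; rewrite /P /= !in_itv /= andbT => /andP[].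
  exact: modulus_cpow_integrable.
have r0 : (0 : R) < 2^-1 by [].
have i2 : mu.-integrable P (EFin \o (fun t => 4 * exponential_pdf 2^-1 t)).
  have i := integrable_exponential_pdf r0.
  have i' := @integrableS _ _ _ mu setT P _ measurableT (measurable_itv _) (@subsetT _ _) i.
  exact: (@integrableZl _ _ _ mu P (measurable_itv _) 4 _ i').
have i3 := @integrableD _ _ _ mu P (measurable_itv _) _ _ i1 i2.
apply: (le_integrable _ _ _ i3); first exact: measurable_itv.
  apply/measurable_EFinP; apply: measurable_funM; last first.
    by apply: measurableT_comp => //; exact: measurableT_comp.
  rewrite (_ : (fun t => _) = (fun t => expR (a * ln t))); last first.
    by apply/funext => t; rewrite modulus_cpow.
  apply: measurable_funTS; apply: measurableT_comp => //.
  by apply: measurable_funM => //; exact: measurable_ln.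
move=> t Pt; have t0 : 0 < t by move: Pt; rewrite /P /= in_itv /= andbT.
rewrite /= ger0_norm; last by rewrite mulr_ge0 ?modulus_ge0 ?expR_ge0.
rewrite (exponential_pdfE _ (ltW t0)).
(* The exponential density of rate 1/2 carries the factor 1/2, hence the 4. *)
have e4 : 4 * (2^-1 * expR (- 2^-1 * t)) = 2 * expR (- 2^-1 * t) by field.
rewrite e4 patchE; case: ifPn => [|]; rewrite ?(inE, notin_setE) /= in_itv /= t0 /= => t1.
  rewrite lee_fin ger0_norm; last first.
    by rewrite addr_ge0 ?modulus_ge0// mulr_ge0 ?expR_ge0.
  apply: (@le_trans _ _ (modulus (cpow z t))); last by rewrite lerDl mulr_ge0 ?expR_ge0.
  rewrite -[leRHS]mulr1 ler_wpM2l ?modulus_ge0//.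
  by rewrite -expR0 ler_expR oppr_le0 ltW.
rewrite add0r lee_fin ger0_norm; last by rewrite mulr_ge0 ?expR_ge0.
rewrite modulus_cpow -/a.
have {}t1 : 1 <= t by move/negP : t1; rewrite -ltNge => /ltW.
have l0 : 0 <= ln t by exact: ln_ge0.
apply: (@le_trans _ _ (t * expR (- t))).
  rewrite ler_wpM2r ?expR_ge0// -[leRHS]lnK// ler_expR.
  by rewrite -[leRHS]mul1r ler_wpM2r// ltW.
have -> : expR (- t) = expR (- 2^-1 * t) * expR (- 2^-1 * t).
  by rewrite -expRD; congr expR; field.
rewrite mulrA ler_wpM2r ?expR_ge0//.
have e := expR_ge1Dx (2^-1 * t).
have -> : expR (- 2^-1 * t) = (expR (2^-1 * t))^-1 by rewrite mulNr expRN.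
rewrite ler_pdivrMr ?expR_gt0//; lra.
Qed.

Section Projection.
Variable pr : C -> R.
Hypothesis prD : forall z w, pr (z + w) = pr z + pr w.
Hypothesis prle : forall z, `|pr z| <= modulus z.
Hypothesis prZ : forall x z, pr (ofR x * z) = x * pr z.

Lemma gauss_cvg_pr z : modulus z < 1 ->
  pr (N.+1`!%:R * cpow (z + 1) N.+1%:R / gauss_prod N.+1 z) @[N --> \oo] -->
  \int[mu]_(t in P) pr (cpow z t * ofR (expR (- t))).
Proof.
move=> z1.
have a10 : 0 < complex.Re z + 1.
  have /andP[a1 a2] : -1 < complex.Re z < 1.
    by rewrite -ltr_norml; apply: le_lt_trans z1; exact: modulus_Re.
  lra.
pose f N t := (1 - t / N.+1%:R) ^+ N.+1 * pr (cpow z t).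
pose F N := (EFin \o f N) \_ (`]0, N.+1%:R] : set R).
pose g t := pr (cpow z t * ofR (expR (- t))).
have gE t : g t = expR (- t) * pr (cpow z t) by rewrite /g mulrC prZ.
have subP N : (`]0, N.+1%:R] : set R) `<=` P.
  by move=> t; rewrite /P /= !in_itv /= andbT => /andP[].
have mpr : measurable_fun P (fun t => pr (cpow z t)).
  apply: open_continuous_measurable_fun => // t; rewrite inE /P /= in_itv /= andbT => t0.
  have := @pr_cpow_continuous _ pr prD prle prZ 1 z t t0.
  by rewrite (_ : (fun t => pr (1 * cpow z t)) = (fun t => pr (cpow z t)))//; apply/funext => x;
    rewrite mul1r.
have mF N : measurable_fun P (F N).
  apply: (iffLR (measurable_restrict _ (measurable_itv _) (measurable_itv _))).
  apply/measurable_EFinP; apply: measurable_funM.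
    by apply: measurable_funTS; apply: measurable_funX; apply: measurable_funB => //;
      exact: measurable_funM.
  exact: (measurable_funS (measurable_itv _) (@subIsetl _ _ _) mpr).
have mg : measurable_fun P (EFin \o g).
  apply/measurable_EFinP; rewrite (_ : g = (fun t => expR (- t) * pr (cpow z t)));
    last exact/funext.
  apply: measurable_funM => //; apply: measurable_funTS.
  by apply: measurableT_comp => //; exact: measurableT_comp.
have [||ig _] := @dominated_convergence _ _ _ mu P (measurable_itv _) F (EFin \o g) _ mF mg _
  (pos_dominant_integrable z1).
- apply: aeW => t Pt; have t0 : 0 < t by move: Pt; rewrite /P /= in_itv /= andbT.
  apply: (@cvg_trans _ ((EFin \o f ^~ t) @ \oo)).
    apply: near_eq_cvg; near=> N; rewrite /F patchE mem_set//= in_itv /= t0 /=.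
    apply: (@le_trans _ _ (N%:R)); last by rewrite ler_nat.
    by near: N; exact: nbhs_infty_ger.
  apply: cvg_EFin; first exact: nearW.
  by rewrite gE; apply: cvgMl; apply: gauss_exp_cvg; exact: ltW.
- apply: aeW => t N Pt; have t0 : 0 < t by move: Pt; rewrite /P /= in_itv /= andbT.
  rewrite /F patchE; case: ifPn => [|_]; last first.
    by rewrite abse0 lee_fin mulr_ge0 ?modulus_ge0 ?expR_ge0.
  rewrite inE /= in_itv /= t0 /= => tN; rewrite lee_fin normrM mulrC; apply: ler_pM => //.
  rewrite ger0_norm; first by apply: gauss_exp_le; rewrite ltW.
  by rewrite exprn_ge0// subr_ge0 ler_pdivrMr// mul1r.
move=> h.
have E N : (\int[mu]_(t in P) F N t = (pr (N.+1`!%:R * cpow (z + 1) N.+1%:R / gauss_prod N.+1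
  z))%:E)%E.
  have [i1 i2] := @gauss_integral _ pr prD prle prZ N.+1 isT N.+1 z a10.
  rewrite /F -integral_mkcondr (setIidr (@subP N)) -i2 /Rintegral fineK//.
  by apply: integrable_fin_num i1; exact: measurable_itv.
move: h; under eq_fun do rewrite E.
have fg := @integrable_fin_num _ _ _ mu P (measurable_itv _) _ ig.
by rewrite -(fineK fg) => h; have [_] := (fine_cvgP _ _).1 h.
Unshelve. all: by end_near. Qed.

End Projection.

Lemma gauss_cvg z : modulus z < 1 ->
  (N.+1`!%:R * cpow (z + 1) N.+1%:R / gauss_prod N.+1 z) @[N --> \oo] --> Gamma (1 + z).
Proof.
move=> z1; apply/cvgC_ReIm.
have E t : cexp ((1 + z - 1) * ofR (ln t)) * ofR (expR (- t)) = cpow z t * ofR (expR (- t)).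
  by rewrite /cpow addrAC subrr add0r.
split.
  have := @gauss_cvg_pr (fun z => complex.Re z) (@ReD R) (@modulus_Re R) (@ReMr R) z z1.
  by under eq_Rintegral do rewrite -E.
have := @gauss_cvg_pr (fun z => complex.Im z) (@ImD R) (@modulus_Im R) (@ImMr R) z z1.
by under eq_Rintegral do rewrite -E.
Qed.

(** The sequence decreases since ln(1 - x) <= -x, and is nonnegative since ln(1
    + x) <= x. The shift by one keeps the logarithm away from 0. *)
Lemma euler_gamma_cvg : (series harmonic N.+1 - ln N.+1%:R) @[N --> \oo] --> euler_gamma R.
Proof.
pose e N : R := series harmonic N.+1 - ln N.+1%:R.
have ce : cvgn e.
  apply: nonincreasing_is_cvgn.
    apply/nonincreasing_seqP => N; rewrite /e /series /= [\sum_(0 <= k < N.+2) _]big_nat_recr//=.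
    set S := \sum_(_ <= _ < _) _.
    have : ln (1 - N.+2%:R^-1) <= - (N.+2%:R : R)^-1.
      by apply: le_ln1Dx; rewrite ltrN2 invf_lt1// ltr1n.
    have -> : 1 - (N.+2%:R : R)^-1 = N.+1%:R / N.+2%:R.
      have n0 : N.+2%:R != 0 :> R by [].
      by apply: (mulIf n0); rewrite mulrBl divfK// mulVf// mul1r -[N.+2%:R]natr1 addrK.
    rewrite ln_div ?posrE//.
    move: (ln N.+1%:R) (ln N.+2%:R) (N.+2%:R^-1) => u v w; lra.
  exists 0 => _ [N _ <-]; rewrite /e subr_ge0.
  apply: (@le_trans _ _ (series harmonic N)); last by rewrite /series /= [leRHS]big_nat_recr//=
    lerDl.
  elim: N => [|N IH]; first by rewrite ln1 /series /= big_geq.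
  rewrite /series /= big_nat_recr//=; apply: (@le_trans _ _ (ln N.+1%:R + N.+1%:R^-1));
    last exact: lerD.
  have : ln (1 + N.+1%:R^-1) <= (N.+1%:R : R)^-1.
    by apply: le_ln1Dx; apply: (@lt_le_trans _ _ 0) => //; rewrite ltrN10.
  have -> : 1 + (N.+1%:R : R)^-1 = N.+2%:R / N.+1%:R.
    have n0 : N.+1%:R != 0 :> R by [].
    by apply: (mulIf n0); rewrite mulrDl divfK// mulVf// mul1r natr1.
  rewrite ln_div ?posrE//.
  by move: (ln N.+1%:R) (ln N.+2%:R) (N.+1%:R^-1) => u v w; lra.
suff -> : euler_gamma R = limn e by exact: ce.
by apply: cvg_lim => //; rewrite -cvg_shiftS; exact: ce.
Qed.

Lemma prod_shift z n : \prod_(0 <= k < n) (1 + z / k.+1%:R) = (\prod_(0 <= k < n) (z + 1 +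
  k%:R)) / n`!%:R.
Proof.
elim: n => [|n IH]; first by rewrite !big_geq// fact0 divr1.
rewrite !big_nat_recr//= IH factS natrM -mulrA -mulrA; congr (_ * _).
have n0 : n.+1%:R != 0 :> C by rewrite pnatr_eq0.
have f0 : n`!%:R != 0 :> C by rewrite pnatr_eq0 -lt0n fact_gt0.
have -> : z + 1 + n%:R = z + n.+1%:R by rewrite -natr1; ring.
by move: (n.+1%:R) (n`!%:R) n0 f0 => a b a0 b0; field; rewrite a0 b0.
Qed.

(** All the factors z + k cancel except the last one, which Gauss's integral has
    in excess. *)
Lemma gauss_weierstrass N z : modulus z < 1 ->
  (N.+1`!%:R * cpow (z + 1) N.+1%:R / gauss_prod N.+1 z) * weierstrass_partial z N.+2
   * cexp (z * ofR (series harmonic N.+1 - ln N.+1%:R)) = ofR N.+1%:R / (ofR N.+1%:R + (z + 1)).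
Proof.
move=> z1.
have a10 : 0 < complex.Re z + 1.
  have /andP[a1 a2] : -1 < complex.Re z < 1.
    by rewrite -ltr_norml; apply: le_lt_trans z1; exact: modulus_Re.
  lra.
have -> : weierstrass_partial z N.+2 =
    (\prod_(0 <= k < N.+1) (z + 1 + k%:R)) / N.+1`!%:R * cexp (- (z * ofR (series harmonic N.+1))).
  rewrite /weierstrass_partial big_split /= big_add1 /= prod_shift; congr (_ * _).
  rewrite -cexp_sum big_add1 /= ofR_sum mulr_sumr -sumrN; congr cexp.
  by apply: eq_bigr => k _; rewrite ofRV ofR_nat mulNr.
rewrite cpowD1// /cpow ofRB mulrBr cexpD cexpN.
have -> : gauss_prod N.+1 z = (\prod_(0 <= k < N.+1) (z + 1 + k%:R)) * (ofR N.+1%:R + (z + 1)).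
  by rewrite /gauss_prod big_nat_recr//= ofR_nat [X in _ * X]addrC.
have p0 : \prod_(0 <= k < N.+1) (z + 1 + k%:R) != 0 by exact: (gauss_prod_neq0 N a10).
have q0 : ofR N.+1%:R + (z + 1) != 0 by rewrite addrC ofR_nat; exact: re_shift_neq0.
have f0 : N.+1`!%:R != 0 :> C by rewrite pnatr_eq0 -lt0n fact_gt0.
rewrite [cexp (- (z * _))]cexpN.
have e1 := cexp_neq0 (z * ofR (ln N.+1%:R)).
have e2 := cexp_neq0 (z * ofR (series harmonic N.+1)).
move: p0; move: (\prod_(_ <= _ < _) _) => p p0.
move: q0; move: (ofR N.+1%:R + (z + 1)) => q q0.
move: e1; move: (cexp (z * ofR (ln _))) => e e1.
move: e2; move: (cexp (z * ofR (series _ _))) => e' e2.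
move: f0; move: (N.+1`!%:R) => f f0.
by field; rewrite e1 e2 p0 q0 f0.
Qed.

Lemma Gamma_invGamma z : modulus z < 1 -> Gamma (1 + z) * invGamma z = 1.
Proof.
move=> z1.
have h1 := gauss_cvg z1.
have h2 : weierstrass_partial z N.+2 @[N --> \oo] --> limn (weierstrass_partial z).
  have := @weierstrass_is_cvg R z; move: (limn _) => l.
  by rewrite -(cvg_shiftn 2); under eq_fun do rewrite addn2.
have h3 : cexp (z * ofR (series harmonic N.+1 - ln N.+1%:R)) @[N --> \oo] --> cexp (z * ofR
  (euler_gamma R)).
  by apply: cvg_cexp; apply: cvgMr; apply: cvg_ofR; exact: euler_gamma_cvg.
have h := cvgM (cvgM h1 h2) h3.
have hl : ofR N.+1%:R / (ofR N.+1%:R + (z + 1)) @[N --> \oo] --> (1 : C).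
  have -> : (fun N => ofR N.+1%:R / (ofR N.+1%:R + (z + 1))) =
      (fun N => (1 + (z + 1) * ofR (harmonic N))^-1).
    apply/funext => N /=; have N0 : ofR N.+1%:R != 0 :> C by rewrite ofR_nat pnatr_eq0.
    have -> : ofR N.+1%:R + (z + 1) = ofR N.+1%:R * (1 + (z + 1) * ofR N.+1%:R^-1).
      by rewrite ofRV mulrDr mulr1 mulrCA divff// mulr1.
    by rewrite invfM mulrA divff// mul1r.
  rewrite -[X in _ --> X]invr1; apply: cvgV; first exact: oner_neq0.
  rewrite -[X in _ --> X]addr0 -[X in _ --> _ + X](mulr0 (z + 1)).
  apply: cvgD; first exact: cvg_cst.
  by apply: cvgMr; rewrite -ofR0; apply: cvg_ofR; exact: cvg_harmonic.
have -> : Gamma (1 + z) * invGamma z =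
    Gamma (1 + z) * limn (weierstrass_partial z) * cexp (z * ofR (euler_gamma R)).
  by rewrite /invGamma (mulrC (ofR _) z) -[RHS]mulrA; congr (_ * _); exact: mulrC.
have -> : Gamma (1 + z) * limn (weierstrass_partial z) * cexp (z * ofR (euler_gamma R)) =
    limn (fun N => ofR N.+1%:R / (ofR N.+1%:R + (z + 1))).
  apply/esym/cvgC_lim; under eq_fun do rewrite -gauss_weierstrass//.
  exact: h.
exact: cvgC_lim hl.
Qed.

End GaussLimit.

(** * The roots of z^r = (-1)^(r-1) *)

Section TwistedRoots.
Variable F : numClosedFieldType.

Lemma exists_prim_root n : (0 < n)%N -> exists z : F, n.-primitive_root z.
Proof.
move=> n0; pose p : {poly F} := 'X^n - 1; have [r Dp] := closed_field_poly_normal p.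
rewrite (monicP _) ?monicXnsubC // scale1r in Dp.
have rn1 : all n.-unity_root r by apply/allP=> z; rewrite -root_prod_XsubC -Dp.
have sz_r : (n < (size r).+1)%N by rewrite -(size_prod_XsubC r id) -Dp size_XnsubC.
have ur : uniq r by rewrite -separable_prod_XsubC -Dp separable_Xn_sub_1// pnatr_eq0 -lt0n.
by have /hasP[z _ hz] := has_prim_root n0 rn1 ur sz_r; exists z.
Qed.

(** The list is x0 om^i for i < r, where om is a primitive r-th root of unity.
    The power sums are geometric sums, and the product is X^r - 1 = prod (X -
    om^i) evaluated at X = - 1 / (x0 w). *)
Lemma twisted_roots r : (0 < r)%N -> exists rs : seq F,
  [/\ uniq rs, size rs = r, forall z, (z \in rs) = (z ^+ r == (-1) ^+ r.-1),
      forall n, ~~ (r %| n)%N -> \sum_(x <- rs) x ^+ n = 0 &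
      forall w, \prod_(x <- rs) (1 + x * w) = 1 + w ^+ r].
Proof.
move=> r0; have [om hom] := exists_prim_root r0.
pose x0 : F := r.-root ((-1) ^+ r.-1).
have x0r : x0 ^+ r = (-1) ^+ r.-1 by rewrite /x0 rootCK.
have x00 : x0 != 0 by apply/eqP => h; move/eqP: x0r; rewrite h expr0n gtn_eqF//= eq_sym signr_eq0.
exists [seq x0 * om ^+ i | i <- index_iota 0 r]; split.
- rewrite map_inj_in_uniq ?iota_uniq// => i j; rewrite !mem_index_iota /= => ir jr.
  move=> /(mulfI x00)/eqP; rewrite (eq_prim_root_expr hom) !modn_small// => /eqP //.
- by rewrite size_map size_iota subn0.
- move=> z; apply/mapP/eqP => [[i _ ->]|zr].
    by rewrite exprMn exprAC (prim_expr_order hom) expr1n mulr1.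
  have /(prim_rootP hom)[i hi] : (z / x0) ^+ r = 1 by rewrite expr_div_n zr x0r divff// signr_eq0.
  by exists (nat_of_ord i); rewrite ?mem_index_iota//= -hi mulrC divfK.
- move=> n rn; rewrite big_map.
  under eq_bigr do rewrite exprMn -exprM mulnC exprM.
  rewrite -mulr_sumr; apply/eqP; rewrite mulf_eq0; apply/orP; right.
  have on1 : om ^+ n - 1 != 0.
    rewrite subr_eq0 -[1](expr0 om) (eq_prim_root_expr hom) mod0n; exact: rn.
  rewrite -(mulrI_eq0 _ (mulfI on1)) big_mkord -subrX1.
  by rewrite exprAC (prim_expr_order hom) expr1n subrr.
- move=> w; rewrite big_map.
  have [->|w0] := eqVneq w 0.
    by rewrite expr0n gtn_eqF// addr0 big1// => i _; rewrite mulr0 addr0.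
  (* Each factor is 1 - v om^i, and (- x0)^r = -1. *)
  pose v := - (x0 * w); have v0 : v != 0 by rewrite oppr_eq0 mulf_neq0.
  have -> : \prod_(0 <= i < r) (1 + x0 * om ^+ i * w) = \prod_(0 <= i < r) (v * (v^-1 - om ^+ i)).
    by apply: eq_bigr => i _; rewrite mulrBr divff// /v; ring.
  rewrite big_split /= prodr_const_nat subn0.
  have := congr1 (fun p => p.[v^-1]) (factor_Xn_sub_1 hom).
  rewrite horner_prod; under eq_bigr do rewrite hornerXsubC.
  move=> ->; rewrite hornerD hornerN hornerC hornerXn mulrBr exprVn divff ?expf_neq0// mulr1.
  rewrite /v exprNn exprMn x0r mulrA -exprD.
  have -> : (-1) ^+ (r + r.-1) = -1 :> F.
    by rewrite -signr_odd oddD; case: r r0 {hom x0 x0r x00 v v0} => // r _ /=; rewrite addNb addbb.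
  by rewrite mulN1r opprK.
Qed.

End TwistedRoots.

(** * The functions ell_r *)

Section EllFunctions.
Variable R : realType.
Local Notation C := (Cplx R).
Implicit Types (z w p chi : C) (r : nat).

Lemma modulus_eq1 chi n : (0 < n)%N -> modulus chi ^+ n = 1 -> modulus chi = 1.
Proof.
move=> n0 h; apply: (pexpIrn n0); rewrite ?nnegrE ?modulus_ge0 ?ler01//.
by rewrite h expr1n.
Qed.

Lemma G_modulus r chi : (0 < r)%N -> G R r chi -> modulus chi = 1.
Proof.
move=> r0 h; apply: (@modulus_eq1 _ r) => //.
by rewrite -modulusX h modulusX modulusN modulus1 expr1n.
Qed.

Lemma G_scale_disc r chi z : (0 < r)%N -> G R r chi -> modulus z < 1 -> modulus (chi * z) < 1.
Proof. by move=> r0 /(G_modulus r0) c1 z1; rewrite modulusM c1 mul1r. Qed.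

Lemma ell_unity r chi z : (1 <= r)%N -> chi ^+ r = 1 -> ell r (chi * z) = ell r z.
Proof.
move=> r1 chir; rewrite /ell.
have -> : ell_partial r (chi * z) = ell_partial r z; last by [].
apply/funext => N; rewrite /ell_partial.
case: eqP => [r11|_]; first by move: chir; rewrite r11 expr1 => ->; rewrite mul1r.
by rewrite exprMn chir mul1r.
Qed.

Lemma ell1_0 : ell 1 (0 : C) = 0.
Proof.
rewrite ell1E ?modulus0// mulr0 add0r /log_tail mul0r psum0.
by rewrite /log_prod_coef.
Qed.

Lemma Gamma_neq0 z : modulus z < 1 -> Gamma (1 + z) != 0.
Proof.
by move=> /Gamma_invGamma h; apply/eqP => g; move: h; rewrite g mul0r => /eqP;
  rewrite eq_sym oner_eq0.
Qed.

Lemma invGammaV z : modulus z < 1 -> invGamma z = (Gamma (1 + z))^-1.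
Proof.
move=> z1; apply: (mulfI (Gamma_neq0 z1)).
by rewrite Gamma_invGamma// divff ?Gamma_neq0.
Qed.

Lemma is_log_Gamma1_ell : is_log_Gamma1 (fun z => - @ell R 1 z).
Proof.
split.
- move=> z /unit_discE z1; have [h] := ell1_holo z1; exact: derivableN.
- by rewrite ell1_0 oppr0.
- move=> z /unit_discE z1; rewrite cexpN cexp_ell1// invGammaV// invrK//.
Qed.

(** Differentiating e^f = 1 gives f' e^f = 0, hence f' = 0. *)
Lemma log_branch_unique (f : C -> C) :
  (forall z, modulus z < 1 -> holo f z) -> f 0 = 0 ->
  (forall z, modulus z < 1 -> cexp (f z) = 1) -> forall z, modulus z < 1 -> f z = 0.
Proof.
move=> hf f0 ef z z1; rewrite -f0; apply: disc_const z1 => {}z z1.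
have d := is_derive_holo (hf _ z1).
have d1 := is_deriveC_comp d (is_derive_cexp (f z)).
have d2 : is_derive z 1 (fun=> 1 : C) (cexp (f z) * 'D_1 f z).
  apply: near_eq_is_derive d1; apply: filterS (near_modulus_lt z1) => t; exact: ef.
have e : cexp (f z) * 'D_1 f z = 0.
  have <- := @derive_val _ _ _ _ _ _ _ d2; exact: derive_cst.
have e' : 'D_1 f z = 0.
  by move/eqP: e; rewrite mulf_eq0 (negbTE (cexp_neq0 _)) => /eqP.
exact: is_derive_eq d e'.
Qed.

Lemma log_Gamma1_unique (L : C -> C) : is_log_Gamma1 L ->
  forall z, modulus z < 1 -> L z = - ell 1 z.
Proof.
move=> [hL L0 eL] z z1; apply/eqP; rewrite -subr_eq0 opprK; apply/eqP.
apply: (@log_branch_unique (fun z => L z + ell 1 z)) => //.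
- move=> w w1; apply: holoD; last exact: ell1_holo.
  by apply: Holo; apply: hL; apply/unit_discE.
- by rewrite L0 ell1_0 addr0.
- move=> w w1; rewrite cexpD eL; last exact/unit_discE.
  by rewrite cexp_ell1// Gamma_invGamma.
Qed.

Lemma big_nat_multiples (V : nmodType) (F : nat -> V) r K : (0 < r)%N ->
  (forall n, ~~ (r %| n)%N -> F n = 0) ->
  \sum_(0 <= n < r * K) F n = \sum_(0 <= m < K) F (m * r)%N.
Proof.
move=> r0 F0; elim: K => [|K IH]; first by rewrite muln0 !big_geq.
rewrite mulnS addnC (@big_cat_nat _ _ _ (r * K))//= ?leq_addr// IH big_nat_recr//=; congr (_ + _).
rewrite big_ltn ?ltn_paddr ?leq_addr//; last by rewrite -[X in (X < _)%N]addn0 ltn_add2l.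
rewrite [X in _ + X]big1_seq ?addr0; first by rewrite mulnC.
move=> n /andP[_]; rewrite mem_index_iota => /andP[n1 n2]; apply: F0.
apply/negP => /dvdnP[k nk]; move: n1 n2; rewrite nk [(k * r)%N]mulnC ltn_pmul2l//.
by rewrite -mulnSr ltn_pmul2l// ltnS => h1 h2; move: h1; rewrite ltnNge h2.
Qed.

Section RootEnumeration.
Variables (r : nat) (rs : seq C).
Hypothesis r0 : (0 < r)%N.
Hypothesis urs : uniq rs.
Hypothesis srs : size rs = r.
Hypothesis mrs : forall z, (z \in rs) = (z ^+ r == (-1) ^+ r.-1).
Hypothesis sum_rs : forall n, ~~ (r %| n)%N -> \sum_(x <- rs) x ^+ n = 0.
Hypothesis prod_rs : forall w, \prod_(x <- rs) (1 + x * w) = 1 + w ^+ r.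

Lemma G_enum : G R r = [set` rs].
Proof. by apply/seteqP; split => z /=; rewrite mrs => /eqP. Qed.

Lemma rsG z : z \in rs -> G R r z.
Proof. by rewrite mrs => /eqP. Qed.

Lemma rs_disc chi z : chi \in rs -> modulus z < 1 -> modulus (chi * z) < 1.
Proof. by move=> /rsG; exact: G_scale_disc. Qed.

Lemma sum_rs1 : (2 <= r)%N -> \sum_(x <- rs) x = 0.
Proof.
move=> r2; rewrite -[RHS](sum_rs (n := 1)) ?dvdn1 ?gtn_eqF//.
Qed.

(** Exchanging the sums over chi and n leaves only the n divisible by r. The
    upper bound r K on n corresponds to the bound K on n / r. As r does not
    divide 1, the terms with Euler's constant cancel. *)
Lemma ell_partial_sum z K : (2 <= r)%N ->
  ell_partial r z K = \sum_(chi <- rs) ell_partial 1 (chi * z) (r * K)%N.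
Proof.
move=> r2; rewrite /ell_partial eqxx gtn_eqF//.
rewrite sumrB -[X in _ = X - _](_ : 0 = _) ?sub0r; last first.
  rewrite -mulr_sumr -mulr_suml.
  by rewrite sum_rs1// mul0r mulr0.
congr (- _).
rewrite exchange_big /=.
pose F n : C := if (n < 2)%N then 0 else
  ofR (zeta R n) * ((- z) ^+ n / n%:R) * \sum_(chi <- rs) chi ^+ n.
have E1 : \sum_(2 <= n < r * K) \sum_(chi <- rs) ofR (zeta R n) * ((- (chi * z)) ^+ n / n%:R) =
    \sum_(0 <= n < r * K) F n.
  have E2 n : (2 <= n)%N -> \sum_(chi <- rs) ofR (zeta R n) * ((- (chi * z)) ^+ n / n%:R) = F n.
    move=> n2; rewrite /F ltnNge n2 /= mulr_sumr; apply: eq_bigr => chi _.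
    by rewrite -mulrN exprMn; ring.
  have [K0|K0] := leqP K 0.
    by move: K0; rewrite leqn0 => /eqP ->; rewrite muln0 !big_geq.
  rewrite [RHS](@big_cat_nat _ _ _ 2)//=; last by rewrite (leq_trans r2)// leq_pmulr.
  rewrite [X in _ = X + _]big1_seq ?add0r; last first.
    by move=> n /andP[_]; rewrite mem_index_iota /F => /andP[_ ->].
  by rewrite big_nat [RHS]big_nat; apply: eq_bigr => n /andP[n2 _]; exact: E2.
rewrite E1 big_nat_multiples//; last first.
  by move=> n rn; rewrite /F; case: ifP => // _; rewrite sum_rs// mulr0.
have [K0|K0] := leqP K 0.
  by move: K0; rewrite leqn0 => /eqP ->; rewrite !big_geq.
rewrite [RHS]big_ltn// {1}/F mul0n add0r.
rewrite big_nat [RHS]big_nat; apply: eq_bigr => m /andP[m1 _].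
have mr2 : (2 <= m * r)%N by rewrite (leq_trans r2)// leq_pmull.
rewrite /F ltnNge mr2 /=.
have -> : \sum_(chi <- rs) chi ^+ (m * r) = r%:R * ((-1) ^+ r.-1) ^+ m.
  rewrite big_seq (eq_bigr (fun=> ((-1) ^+ r.-1) ^+ m)); last first.
    by move=> chi /rsG h; rewrite mulnC exprM h.
  by rewrite -big_seq big_const_seq count_predT srs iter_addr_0 mulr_natl.
have rr : r%:R != 0 :> C by rewrite pnatr_eq0 -lt0n.
have mm : m%:R != 0 :> C by rewrite pnatr_eq0 -lt0n.
have -> : (- z) ^+ (m * r) = (- z ^+ r) ^+ m * ((-1) ^+ r.-1) ^+ m.
  rewrite mulnC exprM -exprMn; congr (_ ^+ _).
  rewrite [LHS]exprNn; case: (r) r0 => // q _ /=.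
  by rewrite exprS; ring.
rewrite natrM.
have ss : ((-1) ^+ r.-1) ^+ m * ((-1) ^+ r.-1) ^+ m = 1 :> C.
  by rewrite -exprMn -expr2 sqrr_sign expr1n.
have -> : ofR (zeta R (m * r)) * ((- z ^+ r) ^+ m * ((-1) ^+ r.-1) ^+ m / (m%:R * r%:R)) * (r%:R *
  ((-1) ^+ r.-1) ^+ m) =
  ofR (zeta R (m * r)) * ((- z ^+ r) ^+ m * (((-1) ^+ r.-1) ^+ m * ((-1) ^+ r.-1) ^+ m) / m%:R).
  by move: (m%:R) (r%:R) mm rr => a b a0 b0; field; rewrite a0 b0.
by rewrite ss mulr1.
Qed.

Lemma cvg_sum_seq (s : seq C) (u : C -> nat -> C) (l : C -> C) :
  (forall i, i \in s -> u i @ \oo --> l i) ->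
  (fun n => \sum_(i <- s) u i n) @ \oo --> \sum_(i <- s) l i.
Proof.
elim: s => [|i s IH] h.
  by under eq_fun do rewrite big_nil; rewrite big_nil; exact: cvg_cst.
rewrite big_cons; under eq_fun do rewrite big_cons.
apply: cvgD; first by apply: h; rewrite mem_head.
by apply: IH => j js; apply: h; rewrite inE js orbT.
Qed.

Lemma cvg_prod_seq (s : seq C) (u : C -> nat -> C) (l : C -> C) :
  (forall i, i \in s -> u i @ \oo --> l i) ->
  (fun n => \prod_(i <- s) u i n) @ \oo --> \prod_(i <- s) l i.
Proof.
elim: s => [|i s IH] h.
  by under eq_fun do rewrite big_nil; rewrite big_nil; exact: cvg_cst.
rewrite big_cons; under eq_fun do rewrite big_cons.
apply: cvgM; first by apply: h; rewrite mem_head.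
by apply: IH => j js; apply: h; rewrite inE js orbT.
Qed.

Lemma ell_partial_cvg z : modulus z < 1 ->
  ell_partial r z @ \oo --> \sum_(chi <- rs) ell 1 (chi * z).
Proof.
move=> z1.
have h1 chi : chi \in rs -> ell_partial 1 (chi * z) @ \oo --> ell 1 (chi * z).
  move=> c; have cz := rs_disc c z1; rewrite ell1E//; exact: ell1_cvg.
have [r2|] := leqP 2 r.
  rewrite (_ : ell_partial r z = (fun K => \sum_(chi <- rs) ell_partial 1 (chi * z) (r * K)%N));
    last first.
    by apply/funext => K; exact: ell_partial_sum.
  apply: (cvg_sum_seq (u := fun chi K => ell_partial 1 (chi * z) (r * K)%N)) => chi /h1 h.
  apply: (@cvg_comp _ _ _ (fun K => (r * K)%N) (ell_partial 1 (chi * z)) _ \oo) => //.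
  by apply: cvg_mulnl.
rewrite ltnS leq_eqVlt ltnNge r0 orbF => /eqP r1.
have rs1 : rs = [:: 1].
  move: srs mrs; rewrite r1; case: (rs) => [//|x [|//]] _ m; congr [:: _].
  by have := m x; rewrite mem_head expr1 expr0 => /esym/eqP.
have m1 : (1 : C) \in rs by rewrite rs1 mem_head.
by have := h1 _ m1; rewrite rs1 big_seq1 mul1r r1.
Qed.

Lemma ell_sum z : modulus z < 1 -> ell r z = \sum_(chi <- rs) ell 1 (chi * z).
Proof. by move=> /ell_partial_cvg h; exact: cvgC_lim h. Qed.

Lemma cexp_ell z : modulus z < 1 -> cexp (ell r z) = \prod_(chi <- rs) invGamma (chi * z).
Proof.
move=> z1; rewrite ell_sum// cexp_sum big_seq [RHS]big_seq; apply: eq_bigr => chi c.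
by rewrite cexp_ell1//; exact: rs_disc.
Qed.

Lemma cexp_ell_rem z : 1 \in rs -> modulus z < 1 ->
  cexp (ell r z) = (Gamma (1 + z))^-1 * \prod_(chi <- rem 1 rs) cexp (ell 1 (chi * z)).
Proof.
move=> rs1 z1; rewrite (ell_sum z1) (perm_big _ (perm_to_rem rs1)) /= big_cons mul1r.
have e1 : cexp (ell 1 z) = (Gamma (1 + z))^-1 := etrans (cexp_ell1 z1) (invGammaV z1).
rewrite cexpD.
apply: (congr2 *%R e1).
exact: cexp_sum.
Qed.

Lemma ell_holo z : modulus z < 1 -> holo (@ell R r) z.
Proof.
move=> z1; apply: (@near_holo _ (fun z => \sum_(chi <- rs) ell 1 (chi * z))).
  by apply: filterS (near_modulus_lt z1) => t /ell_sum.
have : forall s : seq C, {subset s <= rs} -> holo (fun z => \sum_(chi <- s) ell 1 (chi * z)) z.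
  elim=> [_|x s IH sub]; first by under eq_fun do rewrite big_nil; exact: holo_cst.
  rewrite (_ : (fun z => _) = (fun z => ell 1 (x * z) + \sum_(chi <- s) ell 1 (chi * z)));
    last first.
    by apply/funext => t; rewrite big_cons.
  apply: holoD; last by apply: IH => y ys; apply: sub; rewrite inE ys orbT.
  apply: (holo_comp (holo_scale x z)); apply: ell1_holo; apply: rs_disc => //.
  by apply: sub; rewrite mem_head.
by apply.
Qed.

(** The factors e^(- chi z / n) cancel because the elements of G_r sum to 0. *)
Lemma product_partialE z N : (2 <= r)%N ->
  product_partial r z N = \prod_(chi <- rs) weierstrass_partial (chi * z) N.
Proof.
move=> r2; rewrite /product_partial /weierstrass_partial exchange_big /=.
apply: eq_bigr => n _; rewrite big_split /=.
have -> : \prod_(i <- rs) cexp (- (i * z) / n%:R) = 1.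
  rewrite -cexp_sum -mulr_suml sumrN -mulr_suml.
  by rewrite sum_rs1// mul0r oppr0 mul0r cexp0.
rewrite mulr1; under eq_bigr do rewrite -mulrA.
by rewrite prod_rs expr_div_n.
Qed.

Lemma product_partial_cvg z : (2 <= r)%N -> modulus z < 1 ->
  product_partial r z @ \oo --> cexp (ell r z).
Proof.
move=> r2 z1; rewrite cexp_ell//.
have -> : \prod_(chi <- rs) invGamma (chi * z) = \prod_(chi <- rs) limn (weierstrass_partial
  (chi * z)).
  rewrite /invGamma big_split /= -cexp_sum -mulr_sumr -mulr_suml.
  by rewrite sum_rs1// mul0r mulr0 cexp0 mul1r.
rewrite (_ : product_partial r z = (fun N => \prod_(chi <- rs) weierstrass_partial (chi * z) N));
  last first.
  by apply/funext => N; exact: product_partialE.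
by apply: (cvg_prod_seq (u := fun chi => weierstrass_partial (chi * z))) => chi _;
  exact: weierstrass_is_cvg.
Qed.

Definition exp_ell_ext z : C := \prod_(chi <- rs) invGamma (chi * z).

Lemma exp_ell_ext_holo z : holo exp_ell_ext z.
Proof.
apply: holo_prod => chi; apply: (holo_comp (holo_scale chi z)).
by apply: Holo; exact: invGamma_entire.
Qed.

Lemma rs_neq0 chi : chi \in rs -> chi != 0.
Proof. by move=> /rsG/(G_modulus r0) h; rewrite -modulus_gt0 h. Qed.

Lemma exp_ell_ext_order p : exists m, zero_order exp_ell_ext p m.
Proof.
apply: zero_order_prod => chi c; have [m hm] := invGamma_order (chi * p).
by exists m; apply: zero_order_scale => //; exact: rs_neq0.
Qed.

(** G_r is closed under inverses, which exchanges the conditions chi z = m and z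
    = chi m. *)
Lemma exp_ell_ext_eq0 z : exp_ell_ext z = 0 <-> (\bigcup_(chi in G R r) ray chi) z.
Proof.
have inv chi : chi \in rs -> chi^-1 \in rs.
  rewrite !mrs => /eqP h; rewrite exprVn h; apply/eqP.
  by rewrite -exprVn invrN1.
split.
  move/eqP; rewrite prodf_seq_eq0 => /hasP[chi c /= /eqP/invGamma_eq0 h].
  exists chi^-1; first exact/rsG/inv.
  by exists (chi * z) => //; rewrite mulrA mulVf ?mul1r ?rs_neq0.
move=> [chi]; rewrite G_enum /= => c [m mneg <-].
apply/eqP; rewrite prodf_seq_eq0; apply/hasP; exists chi^-1; first exact: inv.
by apply/eqP/invGamma_eq0; rewrite mulrA mulVf ?mul1r ?rs_neq0.
Qed.

Lemma exp_ell_ext_isolated p : exp_ell_ext p = 0 -> \forall z \near p, exp_ell_ext z = 0 -> z = p.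
Proof.
move=> p0; have [m [h [dh h0 fh]]] := exp_ell_ext_order p.
have ch : h t @[t --> p] --> h p by apply: holo_continuous; exact: nbhs_singleton dh.
have nh : \forall z \near p, h z != 0.
  exact: (cvgr_neq0 _ ch h0).
apply: filterS2 fh nh => z -> hz /eqP; rewrite mulf_eq0 (negbTE hz) orbF expf_eq0 subr_eq0.
by move=> /andP[_ /eqP].
Qed.

Lemma exp_ell_ext_inv_pole p : exp_ell_ext p = 0 -> pole (fun z => (exp_ell_ext z)^-1) p.
Proof.
move=> p0; have [m om] := exp_ell_ext_order p; have [h [dh h0 fh]] := om.
have ch : h t @[t --> p] --> h p by apply: holo_continuous; exact: nbhs_singleton dh.
have nh : \forall z \near p, h z != 0 by exact: (cvgr_neq0 _ ch h0).
exists m, (fun z => (h z)^-1); split.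
- by rewrite -(zero_order_eq0 om) p0.
- by apply: filterS2 dh nh => z hz z0; apply/holoP; exact: holo_inv.
- by rewrite invr_neq0.
- apply: (@nbhs_dnbhs _ p); apply: filterS fh => z ->; by rewrite invfM mulrC.
Qed.

Lemma exp_ell_ext_inv_holo p : exp_ell_ext p != 0 -> \forall z \near p,
  holo (fun z => (exp_ell_ext z)^-1) z.
Proof.
move=> p0; have ce : exp_ell_ext t @[t --> p] --> exp_ell_ext p by apply: holo_continuous;
  exact: exp_ell_ext_holo.
have ne : \forall z \near p, exp_ell_ext z != 0 by exact: (cvgr_neq0 _ ce p0).
by apply: filterS ne => z z0; exact: (holo_inv (exp_ell_ext_holo z) z0).
Qed.

(** If f = g / (z - p)^m near p with m > 0 and f is continuous at p, then g = f
    (z - p)^m tends to 0 at p. *)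
Lemma not_pole_holo (f : C -> C) p : holo f p -> ~ pole f p.
Proof.
move=> hf [m [g [m0 dg g0 fg]]].
have cg : g t @[t --> p] --> g p by apply: holo_continuous; apply/holoP; exact: nbhs_singleton dg.
have hfm : holo (fun t => f t * (t - p) ^+ m) p.
  exact: (holoM hf (holo_exp m (holoD (holo_id p) (holo_cst (- p) p)))).
have cf := holo_continuous hfm.
have cg' : g t @[t --> p^'] --> g p.
  by apply/cvgCP => e e0; have /cvgCP/(_ e e0) := cg; exact: (@nbhs_dnbhs _ p).
have cf' : (f t * (t - p) ^+ m) @[t --> p^'] --> (0 : C).
  have e0 : f p * (p - p) ^+ m = 0 by rewrite subrr expr0n gtn_eqF// mulr0.
  rewrite -[X in _ --> X]e0.
  by apply/cvgCP => e e1; have /cvgCP/(_ e e1) := cf; exact: (@nbhs_dnbhs _ p).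
have cf2 : g t @[t --> p^'] --> (0 : C).
  apply: cvg_trans cf'; apply: near_eq_cvg.
  have np : \forall z \near p^', z != p by exact: nbhs_dnbhs_neq.
  apply: filterS2 fg np => z -> zp; rewrite divfK// expf_neq0// subr_eq0//.
by move: g0; rewrite (cvg_unique _ cg' cf2)// eqxx.
Qed.

End RootEnumeration.

(** A negative integer is determined by the modulus of its multiple by chi. *)
Lemma ray_trivIset r : (0 < r)%N -> trivIset (G R r) (@ray R).
Proof.
move=> r0 chi chi' c c' [z [[m hm <-] [m' hm' e]]].
have [n n0 mn] := (negative_integersP _).1 hm.
have [n' n0' mn'] := (negative_integersP _).1 hm'.
have := congr1 (@modulus R) e; rewrite !modulusM (G_modulus r0 c) (G_modulus r0 c') !mul1r.
rewrite mn mn' !modulusN !modulus_nat => /eqP; rewrite eqr_nat => /eqP nn.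
have nz : - n%:R != 0 :> C by rewrite oppr_eq0 pnatr_eq0 -lt0n.
by apply: (mulIf nz); rewrite -{1}mn -[in RHS]nn -mn' e.
Qed.

Lemma rays_countable r : (0 < r)%N -> countable (\bigcup_(chi in G R r) @ray R chi).
Proof.
move=> r0; have [rs [_ _ mrs _ _]] := twisted_roots C r0.
apply: bigcup_countable.
  rewrite (G_enum mrs); apply: finite_set_countable; exact: finite_seq.
move=> chi _; apply: card_le_trans (card_image_le _ _) _.
by apply: card_le_trans (card_image_le _ _) _; exact: countableP.
Qed.

End EllFunctions.

Theorem proposition2p13 (R : realType) :
  (* 1 *)
  ((forall (r : nat) (chi z : Cplx R),
      (1 <= r)%N -> unity_roots R r chi -> unit_disc z ->
      ell r z = ell r (chi * z) /\ cexp (ell r z) = cexp (ell r (chi * z)))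
   /\
   (forall r : nat, (1 <= r)%N -> ~~ odd r ->
      unity_roots R r (-1) /\
      forall z : Cplx R, unit_disc z ->
        ell r (- z) = ell r z /\ cexp (ell r (- z)) = cexp (ell r z)))
  /\
  (* 2 *)
  ((exists L : Cplx R -> Cplx R, is_log_Gamma1 L) /\
   (forall L : Cplx R -> Cplx R, is_log_Gamma1 L ->
      forall (r : nat) (z : Cplx R), (1 <= r)%N -> unit_disc z ->
        ell r z = - \sum_(chi \in G R r) L (chi * z)) /\
   (forall (r : nat) (z : Cplx R), (1 <= r)%N -> unit_disc z ->
      (forall chi, G R r chi -> cvgn (weierstrass_partial (chi * z))) /\
      cexp (ell r z) =
        fsprod (G R r) (fun chi =>
          cexp (ofR (euler_gamma R) * chi * z)
          * limn (weierstrass_partial (chi * z)))))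
  /\
  (* 3 *)
  (forall (r : nat) (z : Cplx R), (2 <= r)%N -> odd r -> unit_disc z ->
     (Gamma_y r (1 + z))^-1 = cexp (ell r z) /\
     cexp (ell r z) =
       (Gamma (1 + z))^-1
       * fsprod (G R r `\ 1) (fun chi => cexp (ell 1 (chi * z))))
  /\
  (* 4 *)
  (forall (r : nat) (z : Cplx R), (2 <= r)%N -> unit_disc z ->
     cexp (ell r z) = fsprod (G R r) (fun chi => cexp (ell 1 (chi * z))) /\
     product_partial r z @ \oo --> cexp (ell r z))
  /\
  (* 5 *)
  (forall r : nat, (1 <= r)%N ->
     (forall z : Cplx R, unit_disc z -> cvgn (ell_partial r z)) /\
     holomorphic_on unit_disc (@ell R r))
  /\
  (* 6 *)
  (forall r : nat, (1 <= r)%N ->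
     let S := \bigcup_(chi in G R r) ray chi in
     [/\ trivIset (G R r) (@ray R), countable S, S `<=` isolated S,
         exists E : Cplx R -> Cplx R,
           [/\ entire E,
               forall z, unit_disc z -> E z = cexp (ell r z) &
               [set z | E z = 0] = S] &
         exists M : Cplx R -> Cplx R,
           [/\ meromorphic M,
               forall z, unit_disc z -> M z = cexp (- ell r z) &
               [set p | pole M p] = S]]).
Proof.
split.
  split.
    move=> r chi z r1 chir _; have e := esym (ell_unity z r1 chir).
    exact: (conj e (congr1 (@cexp R) e)).
  move=> r r1 ro.
  have m1 : unity_roots R r (-1) by rewrite /unity_roots /= -signr_odd (negbTE ro).
  split; first exact: m1.
  move=> z _; have e := etrans (congr1 (ell r) (esym (mulN1r z))) (ell_unity z r1 m1).
  exact: (conj e (congr1 (@cexp R) e)).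
split.
  split; first by exists (fun z => - @ell R 1 z); exact: is_log_Gamma1_ell.
  split.
    move=> L hL r z r1 /unit_discE z1.
    have [rs [u s m sm pr]] := twisted_roots (Cplx R) r1.
    rewrite (ell_sum r1 s m sm z1) (G_enum m) -fsbig_seq// -sumrN big_seq [RHS]big_seq.
    apply: eq_bigr => chi c; rewrite (log_Gamma1_unique hL) ?opprK//.
    exact: (rs_disc r1 m c).
  move=> r z r1 /unit_discE z1.
  have [rs [u s m sm pr]] := twisted_roots (Cplx R) r1.
  split; first by move=> chi _; exact: weierstrass_is_cvg.
  rewrite (cexp_ell r1 s m sm z1) /fsprod (G_enum m) -fsbig_seq//.
  by apply: eq_bigr => chi _; rewrite /invGamma mulrA.
split.
  move=> r z r2 ro /unit_discE z1; have r1 := ltnW r2.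
  have [rs [u s m sm pr]] := twisted_roots (Cplx R) r1.
  split; first by rewrite /Gamma_y addrAC subrr add0r cexpN invrK.
  have m1 : (1 : Cplx R) \in rs.
    by rewrite m expr1n; case: (r) r1 ro => // q _ /=; rewrite -signr_odd => /negbTE ->.
  apply: (etrans (cexp_ell_rem r1 s m sm m1 z1)); apply: (congr1 ( *%R _)).
  have -> : G R r `\ 1 = [set` rem 1 rs].
    apply/seteqP; split => x /=; rewrite mem_rem_uniq// inE /= m.
      by move=> [/eqP -> /eqP ->].
    by move=> /andP[/eqP ? /eqP ?]; split.
  by rewrite /fsprod -fsbig_seq// rem_uniq.
split.
  move=> r z r2 /unit_discE z1; have r1 := ltnW r2.
  have [rs [u s m sm pr]] := twisted_roots (Cplx R) r1.
  split; last exact: (product_partial_cvg r1 s m sm pr r2 z1).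
  by rewrite (ell_sum r1 s m sm z1) cexp_sum /fsprod (G_enum m) -fsbig_seq.
split.
  move=> r r1; have [rs [u s m sm pr]] := twisted_roots (Cplx R) r1.
  split=> z /unit_discE z1.
    by apply/cvg_ex; eexists; exact: (ell_partial_cvg r1 s m sm z1).
  by apply/holoP; exact: (ell_holo r1 s m sm z1).
move=> r r1 S; have [rs [u s m sm pr]] := twisted_roots (Cplx R) r1.
have SE z : exp_ell_ext rs z = 0 <-> S z by exact: (exp_ell_ext_eq0 r1 m).
split.
- exact: ray_trivIset.
- exact: rays_countable.
- move=> p Sp; split; first by rewrite inE.
  have /(exp_ell_ext_isolated r1 m) np := (SE p).2 Sp.
  exists [set z | exp_ell_ext rs z = 0 -> z = p] => //.
  apply/seteqP; split => z /=; first by move=> [h /SE /h].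
  by move=> ->; split.
- exists (exp_ell_ext rs); split.
  + by move=> z _; apply/holoP; exact: exp_ell_ext_holo.
  + by move=> z /unit_discE z1; rewrite (cexp_ell r1 s m sm z1).
  + by apply/seteqP; split => z /SE.
- exists (fun z => (exp_ell_ext rs z)^-1); split.
  + move=> p; have [p0|p0] := eqVneq (exp_ell_ext rs p) 0.
      by right; exact: (exp_ell_ext_inv_pole r1 m p0).
    left; have := exp_ell_ext_inv_holo p0; apply: filterS => z; exact: (holoP _ _).1.
  + by move=> z /unit_discE z1; rewrite cexpN (cexp_ell r1 s m sm z1).
  + apply/seteqP; split => p /=.
      move=> hp; apply/SE/eqP/negPn/negP => p0.
      by apply: (not_pole_holo _ hp); exact: nbhs_singleton (exp_ell_ext_inv_holo p0).
    by move=> /SE h; exact: (exp_ell_ext_inv_pole r1 m h).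
Qed.
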